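(* Let $4\le n<\infty$ and let $F$ be a field with $\operatorname{char}F\ne2$. Then every PC-map $\mathrm{UT}(n,F)\to\mathrm{UT}(n,F)$ is a composition of a graph automorphism, a standard subcentral PC-map, a quasi-inner automorphism, a field automorphism, and a central PC-map.
   Context: $\mathrm{UT}(n,F)$ is the group of upper unitriangular $n\times n$ matrices over $F$; $\mathrm{T}(n,F)$ the group of invertible upper triangular matrices. $a_{ij}$ denotes entries, $e$ the identity, $e_{ij}$ matrix units, $t_{ij}(\alpha)=e+\alpha e_{ij}$. $[x,y]=xyx^{-1}y^{-1}$. A PC-map is a bijection $\varphi$ of the group with $\varphi([x,y])=[\varphi(x),\varphi(y)]$ for all $x,y$. A quasi-inner automorphism is conjugation by an element of $\mathrm{T}(n,F)$. A field automorphism is $(a_{ij})\mapsto(\theta(a_{ij}))$ for a field automorphism $\theta$ of $F$. The graph automorphism is either the identity or the map $a\mapsto w\,(a^{t})^{-1}w^{-1}$, where $w$ is the matrix with $1$ on the anti-diagonal and $0$ elsewhere (this preserves $\mathrm{UT}(n,F)$). A standard subcentral PC-map is a map $a\mapsto t_{2n}(\alpha a_{12})\,a\,t_{1\,n-1}(\beta a_{n-1\,n})$ for fixed $\alpha,\beta\in F$. A central PC-map is a PC-map of the form $a\mapsto a\,t_{1n}(f(a))$ for some function $f:\mathrm{UT}(n,F)\to F$. *)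

(* Defs.v *)
From HB Require Import structures.
From mathcomp Require Import all_boot all_order all_algebra.
Set Implicit Arguments. Unset Strict Implicit. Unset Printing Implicit Defensive.
Import Order.TTheory GRing.Theory Num.Theory.
Local Open Scope ring_scope.

Section UT.
Variables (F : fieldType) (n : nat).
Notation M := 'M[F]_n.

(* Entry a_{i+1, j+1} with 0-based nat indices; 0 if out of range. *)
Definition ent (A : M) (i j : nat) : F :=
  match @insub _ (fun k => k < n)%N _ i, @insub _ (fun k => k < n)%N _ j with
  | Some i', Some j' => A i' j'
  | _, _ => 0
  end.

Definition is_UT (A : M) : bool :=
  [forall i : 'I_n, forall j : 'I_n,
     ((i == j) ==> (A i j == 1)) && ((j < i)%N ==> (A i j == 0))].

Definition is_T (A : M) : bool :=
  [forall i : 'I_n, forall j : 'I_n, (j < i)%N ==> (A i j == 0)] && (A \in unitmx).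

Definition comm (x y : M) : M := x *m y *m invmx x *m invmx y.

(* matrix unit e_{i+1,j+1} (0-based nat indices) *)
Definition munit (i j : nat) : M :=
  \matrix_(k, l) ((((k : nat) == i) && ((l : nat) == j))%:R : F).

Definition tr (i j : nat) (alpha : F) : M := 1%:M + alpha *: munit i j.

Definition PC_map (phi : M -> M) : Prop :=
  [/\ {in is_UT, forall x, is_UT (phi x)},
      {in is_UT &, injective phi},
      (forall y, is_UT y -> exists2 x, is_UT x & phi x = y)
    & {in is_UT &, forall x y, phi (comm x y) = comm (phi x) (phi y)}].

Definition quasi_inner (P : M) (a : M) : M := P *m a *m invmx P.

Definition field_aut (theta : {rmorphism F -> F}) (a : M) : M := map_mx theta a.

Definition wmx : M := \matrix_(i, j) ((((i : nat) + j)%N == n.-1)%:R : F).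

Definition graph_nontriv (a : M) : M := wmx *m invmx (a^T) *m invmx wmx.

Definition graph_aut (b : bool) : M -> M := if b then graph_nontriv else id.

(* standard subcentral PC-map a |-> t_{2n}(alpha a_12) a t_{1,n-1}(beta a_{n-1,n}) *)
Definition std_subcentral (alpha beta : F) (a : M) : M :=
  tr 1 n.-1 (alpha * ent a 0 1) *m a *m tr 0 (n - 2) (beta * ent a (n - 2) n.-1).

Definition central_map (f : M -> F) (a : M) : M := a *m tr 0 n.-1 (f a).

Definition central_PC (c : M -> M) : Prop :=
  PC_map c /\ exists f : M -> F, forall a, c a = central_map f a.

End UT.

(* Main.v *)
Require Import Defs.
From HB Require Import structures.
From mathcomp Require Import all_boot all_order all_algebra.
From mathcomp Require Import zify ring.
Set Implicit Arguments. Unset Strict Implicit. Unset Printing Implicit Defensive.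
Import GRing.Theory.
Local Open Scope ring_scope.

(** Write [e_i], [e'_j] for the standard columns and rows, [1, 2, y = n-1, z = n]
    for the extreme indices and [V] for the columns vanishing at [y] and [z].

    If [x] commutes with all [[x, w]], then [N = x - 1] satisfies
    [2 N e_pq N = N^2 e_pq + e_pq N^2] for [p < q]; as [char F <> 2] this forces
    [N] to be almost of rank one.  A PC-map [phi] preserves this condition and the
    second centre, so up to the graph automorphism and a subcentral map it sends
    [t_{n-1,n}(1)] to [1 + v e'_z] and [t_{12}(1)] to [1 + e_1 r]; a conjugation
    makes [v = e_y].  Every [1 + v e'_z] with [v] in [V] is a commutator with
    [t_{n-1,n}(1)], so [phi] induces a bijection [f] of [V] with
    [f (a v - v) = phi a (f v) - f v].  Commutators of matrices supported on the
    last two columns are [s v'_y - s' v_y]: comparing them makes [f] semilinear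
    for a field automorphism, and [f] is triangular, so a triangular conjugation
    and a field automorphism make [f] the identity.  Then [phi] fixes all columns
    but the last.  The mirrored argument on the first two rows gives a linear
    form, killed by a conjugation by [1 + u e'_z], and then [phi] fixes all rows
    but the first.  What remains is a central map. *)

(** * Triangular matrices and commutators *)

Section Triangular.
Variables (F : fieldType) (n : nat).
Implicit Types (A B x y c : 'M[F]_n).

Lemma is_UTP A :
  reflect (forall i j : 'I_n, (j <= i)%N -> A i j = (i == j)%:R) (is_UT A).
Proof.
apply: (iffP forallP) => [H i j | H i].
  move/(_ i)/forallP/(_ j)/andP: H => [/implyP Hd /implyP Hl].
  rewrite leq_eqVlt => /orP[/eqP/val_inj eq_ji | lt_ji].
    by rewrite eq_ji eqxx in Hd *; apply/eqP/Hd.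
  rewrite (eqP (Hl lt_ji)); case: (i =P j) => // eq_ij.
  by rewrite eq_ij ltnn in lt_ji.
apply/forallP=> j; apply/andP; split; apply/implyP.
  by move/eqP <-; rewrite H // eqxx.
move=> lt_ji; rewrite H 1?ltnW //; case: (i =P j) => // eq_ij.
by rewrite eq_ij ltnn in lt_ji.
Qed.

Lemma UT_low A (i j : 'I_n) : is_UT A -> (j < i)%N -> A i j = 0.
Proof.
move=> /is_UTP UA lt_ji; rewrite UA 1?ltnW //.
by case: (i =P j) => // eq_ij; rewrite eq_ij ltnn in lt_ji.
Qed.

Lemma UT_diag A (i : 'I_n) : is_UT A -> A i i = 1.
Proof. by move=> /is_UTP UA; rewrite UA ?eqxx. Qed.

Lemma is_TP A :
  reflect ((forall i j : 'I_n, (j < i)%N -> A i j = 0) /\ A \in unitmx) (is_T A).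
Proof.
apply: (iffP andP) => -[H ->]; split=> //.
  by move=> i j lt_ji; move/forallP/(_ i)/forallP/(_ j)/implyP/(_ lt_ji)/eqP: H.
by apply/forallP=> i; apply/forallP=> j; apply/implyP => lt_ji; apply/eqP/H.
Qed.

Lemma upper_det A : (forall i j : 'I_n, (j < i)%N -> A i j = 0) ->
  \det A = \prod_i A i i.
Proof.
move=> H; rewrite -det_tr det_trig; last by apply/is_trig_mxP=> i j /H; rewrite mxE.
by apply: eq_bigr => i _; rewrite mxE.
Qed.

Lemma UT_T A : is_UT A -> is_T A.
Proof.
move=> UA; have low (i j : 'I_n) : (j < i)%N -> A i j = 0 by apply: UT_low.
apply/is_TP; split=> //; rewrite unitmxE upper_det //.
by rewrite big1 ?unitr1 // => i _; rewrite UT_diag.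
Qed.

Lemma is_T_unit A : is_T A -> A \in unitmx. Proof. by case/is_TP. Qed.

Lemma UT_unit A : is_UT A -> A \in unitmx.
Proof. by move/UT_T/is_T_unit. Qed.

Lemma T_diag_neq0 A i : is_T A -> A i i != 0.
Proof.
case/is_TP=> low; rewrite unitmxE upper_det // unitfE prodf_seq_neq0.
by move/allP/(_ i); apply; rewrite mem_index_enum.
Qed.

(** Induction from the bottom row upwards: in row [i] of [A *m invmx A = 1%:M] the terms with
    [l < i] vanish because [A] is upper triangular, those with [l > i] by the induction hypothesis,
    and only [A i i * invmx A i j] survives. *)
Lemma T_inv_entry A (i j : 'I_n) : is_T A -> (j <= i)%N ->
  invmx A i j = (A i i)^-1 * (i == j)%:R.
Proof.
move=> TA; have [low uA] := is_TP _ TA.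
have [k] := ubnP (n - i); elim: k i j => // k IH i j lek le_ji.
have: (A *m invmx A) i j = (i == j)%:R by rewrite mulmxV // mxE.
rewrite mxE (bigD1 i) //= big1 ?addr0 => [<-|l ne_li].
  by rewrite mulKf // T_diag_neq0.
have [lt_li|le_il] := ltnP l i; first by rewrite low ?mul0r.
have lt_il : (i < l)%N by rewrite ltn_neqAle le_il eq_sym ne_li.
rewrite IH; [ | have := ltn_ord l; lia | lia].
by case: (l =P j) => [elj|_]; [move: lt_il; rewrite elj; lia | rewrite !mulr0].
Qed.

Lemma T_inv A : is_T A -> is_T (invmx A).
Proof.
move=> TA; have [low uA] := is_TP _ TA; apply/is_TP; rewrite unitmx_inv.
split=> // i j lt_ji; rewrite T_inv_entry 1?ltnW //.
by case: (i =P j) => [eij|_]; [move: lt_ji; rewrite eij ltnn | rewrite mulr0].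
Qed.

Lemma UT_inv A : is_UT A -> is_UT (invmx A).
Proof.
move=> UA; apply/is_UTP=> i j le_ji.
by rewrite T_inv_entry ?UT_T // UT_diag // invr1 mul1r.
Qed.

Lemma upper_mul_entry A B (i j : 'I_n) :
  (forall i j : 'I_n, (j < i)%N -> A i j = 0) ->
  (forall i j : 'I_n, (j < i)%N -> B i j = 0) ->
  (j <= i)%N -> (A *m B) i j = A i i * B i j.
Proof.
move=> lA lB le_ji; rewrite mxE (bigD1 i) //= big1 ?addr0 // => k ne_ki.
have [lt_ki|le_ik] := ltnP k i; first by rewrite lA ?mul0r.
rewrite lB ?mulr0 //; apply: leq_ltn_trans le_ji _.
by rewrite ltn_neqAle le_ik eq_sym ne_ki.
Qed.

Lemma T_mul A B : is_T A -> is_T B -> is_T (A *m B).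
Proof.
move=> /is_TP[lA uA] /is_TP[lB uB]; apply/is_TP; rewrite unitmx_mul uA uB.
by split=> // i j lt_ji; rewrite upper_mul_entry 1?ltnW // lB ?mulr0.
Qed.

Lemma UT_mul A B : is_UT A -> is_UT B -> is_UT (A *m B).
Proof.
move=> UA UB; apply/is_UTP=> i j le_ji; rewrite upper_mul_entry //.
- by rewrite UT_diag // mul1r (is_UTP _ UB).
- by move=> ? ?; apply: UT_low.
- by move=> ? ?; apply: UT_low.
Qed.

Lemma UT1 : is_UT (1%:M : 'M[F]_n).
Proof. by apply/is_UTP=> i j _; rewrite mxE. Qed.

Lemma UT_comm x y : is_UT x -> is_UT y -> is_UT (comm x y).
Proof. by move=> Ux Uy; rewrite !UT_mul ?UT_inv. Qed.

Lemma comm_mulK x y : is_UT x -> is_UT y -> comm x y *m (y *m x) = x *m y.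
Proof.
by move=> Ux Uy; rewrite /comm mulmxA !mulmxKV ?UT_unit.
Qed.

(** A criterion by multiplication only; most commutators below are computed through it. *)
Lemma comm_eq x y c : is_UT x -> is_UT y ->
  x *m y = c *m (y *m x) -> comm x y = c.
Proof.
by move=> Ux Uy Exy; rewrite /comm Exy mulmxA !mulmxK ?UT_unit.
Qed.

Lemma comm_eq1 x y : is_UT x -> is_UT y ->
  comm x y = 1%:M <-> x *m y = y *m x.
Proof.
move=> Ux Uy; split=> [E|E]; first by rewrite -(comm_mulK Ux Uy) E mul1mx.
by apply: comm_eq => //; rewrite mul1mx.
Qed.

Lemma commute_inv x y : is_UT y -> x *m y = y *m x ->
  x *m invmx y = invmx y *m x.
Proof.
move=> Uy E; rewrite -[RHS](mulmxK (UT_unit Uy)) -(mulmxA _ x) E.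
by rewrite mulmxA mulVmx ?UT_unit // mul1mx.
Qed.

Lemma invmx_mul A B : A \in unitmx -> B \in unitmx ->
  invmx (A *m B) = invmx B *m invmx A.
Proof.
move=> uA uB; have uAB : A *m B \in unitmx by rewrite unitmx_mul uA.
apply: (can_inj (mulKmx uAB)); rewrite mulmxV //.
by rewrite mulmxA mulmxK // mulmxV.
Qed.

(** Written as [x (w x w^-1)^-1], the commutator lies in the group generated by [x] and its
    conjugate. *)
Lemma commute_comm u x w : is_UT x -> is_UT w ->
  u *m x = x *m u ->
  u *m (w *m x *m invmx w) = (w *m x *m invmx w) *m u ->
  u *m comm x w = comm x w *m u.
Proof.
move=> Ux Uw E1 E2.
have Uc : is_UT (w *m x *m invmx w) by rewrite !UT_mul ?UT_inv.
have -> : comm x w = x *m invmx (w *m x *m invmx w).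
  by rewrite !invmx_mul ?unitmx_mul ?unitmx_inv ?UT_unit // invmxK /comm !mulmxA.
by rewrite mulmxA E1 -(mulmxA x u) (commute_inv Uc E2) mulmxA.
Qed.

(** A converse for [u = x]: cancelling [x] in [x (w x w^-1)^-1] leaves the inverse of the
    conjugate. *)
Lemma commute_conj x w : is_UT x -> is_UT w ->
  x *m comm x w = comm x w *m x ->
  x *m (w *m x *m invmx w) = (w *m x *m invmx w) *m x.
Proof.
move=> Ux Uw E.
have Uc : is_UT (w *m x *m invmx w) by rewrite !UT_mul ?UT_inv.
have Ec : comm x w = x *m invmx (w *m x *m invmx w).
  by rewrite !invmx_mul ?unitmx_mul ?unitmx_inv ?UT_unit // invmxK /comm !mulmxA.
have E' : x *m invmx (w *m x *m invmx w) = invmx (w *m x *m invmx w) *m x.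
  by apply: (can_inj (mulKmx (UT_unit Ux))); rewrite -Ec E Ec mulmxA.
by rewrite -[w *m x *m invmx w]invmxK commute_inv // UT_inv.
Qed.

End Triangular.

(** * PC-maps *)

Section PCMaps.
Variables (F : fieldType) (n : nat).
Implicit Types (x y w A B : 'M[F]_n) (phi psi : 'M[F]_n -> 'M[F]_n).

Lemma PC_UT phi x : PC_map phi -> is_UT x -> is_UT (phi x).
Proof. by case=> H _ _ _; apply: H. Qed.

Lemma PC_surj phi y : PC_map phi -> is_UT y -> exists2 x, is_UT x & phi x = y.
Proof. by case=> _ _ H _; apply: H. Qed.

Lemma PC_comm phi x y : PC_map phi -> is_UT x -> is_UT y ->
  phi (comm x y) = comm (phi x) (phi y).
Proof. by case=> _ _ _ H; apply: H. Qed.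

Lemma PC_1 phi : PC_map phi -> phi 1%:M = 1%:M.
Proof.
move=> PC; have U1 := UT1 F n; have U := PC_UT PC U1.
have E : comm 1%:M 1%:M = 1%:M :> 'M[F]_n by apply/(comm_eq1 U1 U1).
by rewrite -{1}E PC_comm //; apply/(comm_eq1 U U).
Qed.

Lemma PC_commute phi x y : PC_map phi -> is_UT x -> is_UT y ->
  phi x *m phi y = phi y *m phi x <-> x *m y = y *m x.
Proof.
move=> PC Ux Uy; have [Ux' Uy'] := (PC_UT PC Ux, PC_UT PC Uy).
split=> [/(comm_eq1 Ux' Uy') E | /(comm_eq1 Ux Uy) E].
  apply/(comm_eq1 Ux Uy); case: (PC) => _ inj _ _; apply: inj.
  - exact: UT_comm.
  - exact: UT1.
  - by rewrite PC_comm // E PC_1.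
by apply/(comm_eq1 Ux' Uy'); rewrite -PC_comm // E PC_1.
Qed.

(** [PC_map] constrains values on unitriangular matrices only; this transfers it to the central map
    at the end, which agrees with [phi] only there. *)
Lemma PC_ext phi psi : {in @is_UT F n, phi =1 psi} -> PC_map phi -> PC_map psi.
Proof.
move=> E [H1 H2 H3 H4]; have E' x : is_UT x -> psi x = phi x by move=> Ux; rewrite E.
split.
- by move=> x Ux; rewrite E' //; apply: H1.
- by move=> x y Ux Uy; rewrite !E' //; apply: H2.
- by move=> y /H3[x Ux <-]; exists x => //; rewrite E'.
- by move=> x y Ux Uy; rewrite !E' ?H4 // UT_comm.
Qed.

Lemma PC_comp phi psi : PC_map phi -> PC_map psi -> PC_map (fun x => psi (phi x)).
Proof.
move=> [H1 H2 H3 H4] [K1 K2 K3 K4]; split.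
- by move=> x Ux; apply/K1/H1.
- by move=> x y Ux Uy /K2 E; apply: H2 => //; apply: E; apply: H1.
- by move=> y /K3[u /H3[x Ux <-] <-]; exists x.
- by move=> x y Ux Uy /=; rewrite H4 // K4 //; apply: H1.
Qed.

Lemma PC_morph phi psi :
  (forall x, is_UT x -> is_UT (phi x)) -> (forall x, is_UT x -> is_UT (psi x)) ->
  (forall x, is_UT x -> psi (phi x) = x) -> (forall x, is_UT x -> phi (psi x) = x) ->
  (forall x y, is_UT x -> is_UT y -> phi (x *m y) = phi x *m phi y) ->
  PC_map phi.
Proof.
move=> Uphi Upsi K1 K2 M; split=> //.
- by move=> x y Ux Uy E; rewrite -(K1 x) // E K1.
- by move=> y Uy; exists (psi y); rewrite ?Upsi ?K2.
move=> x y Ux Uy; apply/esym.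
apply: comm_eq; rewrite ?Uphi //.
rewrite -(M x y) // -(M y x) // -M; [|exact: UT_comm|exact: UT_mul].
by rewrite comm_mulK.
Qed.

Lemma PC_conj (P : 'M[F]_n) : is_T P -> PC_map (quasi_inner P).
Proof.
move=> TP; have uP := is_T_unit TP.
have UQ A x : is_T A -> is_UT x -> is_UT (quasi_inner A x).
  move=> TA Ux; have [lA uA] := is_TP _ TA; have [lx ux] := is_TP _ (UT_T Ux).
  have [lI _] := is_TP _ (T_inv TA); have [lAx _] := is_TP _ (T_mul TA (UT_T Ux)).
  apply/is_UTP=> i j le_ji; rewrite /quasi_inner upper_mul_entry //.
  rewrite upper_mul_entry // (UT_diag _ Ux) mulr1 T_inv_entry // mulrA mulfV ?mul1r //.
  exact: T_diag_neq0.
have TI := T_inv TP.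
apply: (@PC_morph _ (quasi_inner (invmx P))).
- by move=> x; apply: UQ.
- by move=> x; apply: UQ.
- by move=> x Ux; rewrite /quasi_inner invmxK !mulmxA mulVmx // mul1mx mulmxKV.
- by move=> x Ux; rewrite /quasi_inner invmxK !mulmxA mulmxV // mul1mx mulmxK.
- by move=> x y Ux Uy; rewrite /quasi_inner !mulmxA mulmxKV.
Qed.

Lemma UT_map (theta : {rmorphism F -> F}) x : is_UT x -> is_UT (map_mx theta x).
Proof. by move=> Ux; apply/is_UTP=> i j le_ji; rewrite mxE (is_UTP _ Ux) // rmorph_nat. Qed.

Lemma PC_field (theta theta' : {rmorphism F -> F}) :
  cancel theta theta' -> cancel theta' theta -> PC_map (field_aut (n := n) theta).
Proof.
move=> K1 K2; apply: (@PC_morph _ (field_aut theta')).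
- exact: UT_map.
- exact: UT_map.
- by move=> x _; apply/matrixP=> i j; rewrite !mxE K1.
- by move=> x _; apply/matrixP=> i j; rewrite !mxE K2.
- by move=> x y _ _; apply: map_mxM.
Qed.

Lemma mul_delta_entry A (p q i j : 'I_n) :
  (A *m delta_mx p q) i j = A i p * (j == q)%:R.
Proof.
rewrite mxE (bigD1 p) //= big1 ?addr0 => [|k ne]; first by rewrite mxE eqxx.
by rewrite mxE (negPf ne) mulr0.
Qed.

Lemma delta_mul_entry A (p q i j : 'I_n) :
  (delta_mx p q *m A) i j = (i == p)%:R * A q j.
Proof.
rewrite mxE (bigD1 q) //= big1 ?addr0 => [|k ne]; first by rewrite mxE eqxx andbT.
by rewrite mxE (negPf ne) andbF mul0r.
Qed.

Lemma UT_delta (c : F) (p q : 'I_n) : (p < q)%N -> is_UT (1%:M + c *: delta_mx p q).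
Proof.
move=> lt_pq; apply/is_UTP=> i j le_ji; rewrite !mxE.
case: (i =P p) => [eip|]; last by rewrite mulr0 addr0.
case: (j =P q) => [ejq|]; last by rewrite mulr0 addr0.
by move: le_ji; rewrite eip ejq; lia.
Qed.

Lemma delta_sq0 (p q : 'I_n) : (p < q)%N -> delta_mx p q *m delta_mx p q = 0 :> 'M[F]_n.
Proof.
move=> lt_pq; rewrite mul_delta_mx_cond; case: eqP => // eq_qp.
by rewrite eq_qp ltnn in lt_pq.
Qed.

(** Expressed by commutators alone, hence invariant under PC-maps, although these need not respect
    products. *)
Definition commutes_with_comms x :=
  forall w, is_UT w -> x *m comm x w = comm x w *m x.

Lemma PC_commutes_with_comms phi x : PC_map phi -> is_UT x ->
  commutes_with_comms x -> commutes_with_comms (phi x).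
Proof.
move=> PC Ux H w /(PC_surj PC)[u Uu <-]; rewrite -PC_comm //.
by apply/(PC_commute PC); rewrite ?UT_comm //; apply: H.
Qed.

(** With [E = delta_mx i j], both [E w E] and [E w^-1 E] vanish, since the [(j, i)] entries of [w]
    and [w^-1] lie below the diagonal. Hence [E] and [w E w^-1] have product zero in either
    order. *)
Lemma elementary_commutes_with_comms (i j : 'I_n) : (i < j)%N ->
  commutes_with_comms (1%:M + delta_mx i j).
Proof.
move=> lt_ij w Uw; have := UT_delta 1 lt_ij; rewrite scale1r => Ux.
apply: commute_comm => //.
have -> : w *m (1%:M + delta_mx i j) *m invmx w = 1%:M + w *m delta_mx i j *m invmx w.
  by rewrite mulmxDr mulmx1 mulmxDl mulmxV ?UT_unit.
rewrite !(mulmxDl, mulmxDr) !mul1mx !mulmx1 -!addrA; congr (_ + _).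
rewrite addrCA; congr (_ + (_ + _)).
rewrite -!mulmxA; transitivity (0 : 'M[F]_n).
  have -> : delta_mx i j *m (w *m (delta_mx i j *m invmx w)) =
            (delta_mx i j *m w *m delta_mx i j) *m invmx w by rewrite !mulmxA.
  rewrite [X in X *m _](_ : _ = 0) ?mul0mx //.
  apply/matrixP=> k l; rewrite mul_delta_entry delta_mul_entry.
  by rewrite (UT_low Uw lt_ij) mulr0 mul0r mxE.
rewrite [X in w *m X](_ : _ = 0) ?mulmx0 //.
apply/matrixP=> k l; rewrite delta_mul_entry mul_delta_entry.
by rewrite (UT_low (UT_inv Uw) lt_ij) mul0r mulr0 mxE.
Qed.

(** Subtracting the two hypotheses cancels every term of even degree in [B] and leaves twice the
    claimed identity; the extra factor 2 is then divided out. *)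
Lemma quad_of_conj_commutes A B i j : (2%:R : F) != 0 ->
  A *m (1%:M + B) *m A *m (1%:M - B) = (1%:M + B) *m A *m (1%:M - B) *m A ->
  A *m (1%:M - B) *m A *m (1%:M + B) = (1%:M - B) *m A *m (1%:M + B) *m A ->
  2%:R * (A *m B *m A) i j = (A *m A *m B) i j + (B *m A *m A) i j.
Proof.
move=> hchar; rewrite !(mulmxDl, mulmxDr, mulmxBr, mulmxBl, mul1mx, mulmx1).
rewrite !(mulNmx, mulmxN, opprK).
move: (A *m A) (A *m B *m A) (A *m A *m B) => a b c.
move: (A *m B *m A *m B) (B *m A *m A) (B *m A *m B *m A) => d e f.
move=> /matrixP/(_ i j) + /matrixP/(_ i j).
rewrite !mxE => H1 H2; apply: (mulfI hchar).
move/eqP: H1; rewrite -subr_eq0 => /eqP H1.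
move/eqP: H2; rewrite -subr_eq0 => /eqP H2.
have E := congr2 (fun u v => u - v) H1 H2; rewrite /= subrr in E.
by rewrite -[RHS]addr0 -E; ring.
Qed.

(** * The quadratic identity for [N = x - 1] and its consequences for entries *)

Section SquareZero.
Hypothesis hchar : (2%:R : F) != 0.
Variable x : 'M[F]_n.
Hypotheses (Ux : is_UT x) (Hx : commutes_with_comms x).
Let N := x - 1%:M.

(** [N] commutes with its conjugate under [w = 1 + c e_pq], whose inverse is [1 - c e_pq] because
    [e_pq] squares to zero. *)
Let conj_commutes (c : F) (p q : 'I_n) : (p < q)%N ->
  N *m (1%:M + c *: delta_mx p q) *m N *m (1%:M - c *: delta_mx p q) =
  (1%:M + c *: delta_mx p q) *m N *m (1%:M - c *: delta_mx p q) *m N.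
Proof.
move=> lt_pq; set w := 1%:M + _; set w' := 1%:M - _.
have ww' : w *m w' = 1%:M.
  rewrite mulmxDl mulmxBr !mul1mx mulmxBr mulmx1 -scalemxAl -scalemxAr.
  by rewrite delta_sq0 // !scaler0 subr0 subrK.
have Uw : is_UT w by apply: UT_delta.
have Ew : invmx w = w'.
  by rewrite -[LHS]mulmx1 -ww' mulKmx // UT_unit.
have E := commute_conj Ux Uw (Hx Uw); rewrite Ew in E.
transitivity (N *m (w *m N *m w')); first by rewrite !mulmxA.
have -> : w *m N *m w' = w *m x *m w' - 1%:M.
  by rewrite /N (mulmxBr w) mulmx1 mulmxBl ww'.
move: (w *m x *m w') E => d E.
rewrite /N !mulmxBl !mulmxBr !mul1mx !mulmx1 E.
by move: (d *m x) => dx; apply/matrixP=> i j; rewrite !mxE; ring.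
Qed.

(** The signs [c = 1] and [c = -1] supply the two hypotheses of [quad_of_conj_commutes]. *)
Let quad (p q : 'I_n) i j : (p < q)%N ->
  2%:R * (N i p * N q j) = (N *m N) i p * (j == q)%:R + (i == p)%:R * (N *m N) q j.
Proof.
move=> lt_pq; set E := delta_mx p q : 'M[F]_n.
have H1 := conj_commutes 1 lt_pq; have H2 := conj_commutes (-1) lt_pq.
rewrite -/E !scale1r in H1; rewrite -/E !scaleN1r opprK in H2.
have eb : (N *m E *m N) i j = N i p * N q j.
  by rewrite -mulmxA mxE (bigD1 p) //= big1 ?addr0 ?delta_mul_entry ?eqxx ?mul1r
    // => k ne; rewrite delta_mul_entry (negPf ne) mul0r mulr0.
have ec : (N *m N *m E) i j = (N *m N) i p * (j == q)%:R by rewrite mul_delta_entry.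
have ee : (E *m N *m N) i j = (i == p)%:R * (N *m N) q j.
  by rewrite -mulmxA delta_mul_entry.
rewrite -eb -ec -ee; exact: quad_of_conj_commutes.
Qed.

(** The right-hand side of [quad] is supported on column [q] and row [p]. *)
Lemma square_zero_entries (i p q j : 'I_n) : (p < q)%N -> i != p -> j != q ->
  N i p * N q j = 0.
Proof.
move=> lt_pq /negPf nip /negPf njq; apply: (mulfI hchar).
by rewrite quad // nip njq !mulr0 mul0r addr0.
Qed.

(** Taking [j = q] in [quad] makes the left-hand side contain the diagonal entry [N q q = 0]; the
    row version takes [i = p] instead. *)
Lemma square_zero_col (i p q : 'I_n) : (p < q)%N -> i != p -> (N *m N) i p = 0.
Proof.
move=> lt_pq /negPf nip; have := quad i q lt_pq.
by rewrite nip eqxx mul0r addr0 mulr1 => <-; rewrite !mxE eqxx UT_diag // subrr !mulr0.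
Qed.

Lemma square_zero_row (p q j : 'I_n) : (p < q)%N -> j != q -> (N *m N) q j = 0.
Proof.
move=> lt_pq /negPf njq; have := quad p j lt_pq.
by rewrite njq eqxx mulr0 add0r mul1r => <-; rewrite !mxE eqxx UT_diag // subrr mul0r mulr0.
Qed.
End SquareZero.

End PCMaps.

(** * Elementary matrices in the last column and the center *)

(* The paper's indices 1, 2, n-1, n. *)
Section Indices.
Variable m : nat.
Definition ix0 : 'I_m.+4 := ord0.
Definition ix1 : 'I_m.+4 := Ordinal (isT : (1 < m.+4)%N).
Definition ixy : 'I_m.+4 := Ordinal (ltnW (ltnSn m.+3) : (m.+2 < m.+4)%N).
Definition ixz : 'I_m.+4 := ord_max.
End Indices.

Section RankOne.
Variables (F : fieldType) (m : nat).
Local Notation n := m.+4.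
Local Notation i0 := (ix0 m).
Local Notation i1 := (ix1 m).
Local Notation iy := (ixy m).
Local Notation iz := (ixz m).
Implicit Types (a x y A B C : 'M[F]_n) (v s w : 'cV[F]_n) (r : 'rV[F]_n) (i j k l : 'I_n).

Definition ec k : 'cV[F]_n := delta_mx k 0.
Definition er k : 'rV[F]_n := delta_mx 0 k.

Lemma ec_entry k i (j : 'I_1) : ec k i j = (i == k)%:R.
Proof. by rewrite mxE [j]ord1 eqxx andbT. Qed.

Lemma er_entry k (i : 'I_1) j : er k i j = (j == k)%:R.
Proof. by rewrite mxE [i]ord1 eqxx. Qed.

Lemma ec_er k l : ec k *m er l = delta_mx k l.
Proof. exact: mul_delta_mx. Qed.

Lemma mul_ec A k i : (A *m ec k) i 0 = A i k.
Proof. by rewrite -colE mxE. Qed.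

Lemma er_mul A k j : (er k *m A) 0 j = A k j.
Proof. by rewrite -rowE mxE. Qed.

Lemma er_col k v : er k *m v = (v k 0)%:M.
Proof. by rewrite -rowE; apply/matrixP=> i j; rewrite !ord1 !mxE. Qed.

Lemma row_ec k r : r *m ec k = (r 0 k)%:M.
Proof. by rewrite -colE; apply/matrixP=> i j; rewrite !ord1 !mxE. Qed.

Lemma mul_er_entry v k i j : (v *m er k) i j = v i 0 * (j == k)%:R.
Proof. by rewrite mxE big_ord1 er_entry. Qed.

Lemma ec_mul_entry r k i j : (ec k *m r) i j = (i == k)%:R * r 0 j.
Proof. by rewrite mxE big_ord1 ec_entry. Qed.

Lemma UT_ec0 a : is_UT a -> a *m ec i0 = ec i0.
Proof.
move=> Ua; apply/matrixP=> i j; rewrite [j]ord1 mul_ec ec_entry.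
by rewrite (is_UTP _ Ua).
Qed.

Lemma UT_erz a : is_UT a -> er iz *m a = er iz.
Proof.
move=> Ua; apply/matrixP=> i j; rewrite [i]ord1 er_mul er_entry eq_sym.
by rewrite (is_UTP _ Ua) //; apply: (leq_ord j).
Qed.

Lemma UT_mul_entry_y a v : is_UT a -> v iz 0 = 0 -> (a *m v) iy 0 = v iy 0.
Proof.
move=> Ua vz; rewrite mxE (bigD1 iy) //= UT_diag // mul1r big1 ?addr0 // => k ne.
have [lt|le] := ltnP k iy; first by rewrite (UT_low Ua) ?mul0r.
suff -> : k = iz by rewrite vz mulr0.
apply: ord_inj => /=; move: ne le; rewrite -val_eqE /=; have := ltn_ord k; lia.
Qed.

Lemma UT_mul_entry_z a v : is_UT a -> (a *m v) iz 0 = v iz 0.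
Proof.
move=> Ua; have := congr1 (fun u : 'M_1 => u 0 0) (er_col iz (a *m v)).
by rewrite mulmxA UT_erz // er_col !mxE /= !mulr1n => ->.
Qed.

(** Since [C] kills [A] and [B] from the left, [(1 + C)(1 + B)(1 + A)] is [(1 + B)(1 + A) + C]. *)
Lemma comm_nil A B C : is_UT (1%:M + A) -> is_UT (1%:M + B) ->
  C *m A = 0 -> C *m B = 0 -> A *m B = C + B *m A -> comm (1%:M + A) (1%:M + B) = 1%:M + C.
Proof.
move=> UA UB CA CB E; apply: comm_eq => //.
rewrite !(mulmxDl, mulmxDr, mul1mx, mulmx1) E.
rewrite mulmxA CA CB mul0mx !addr0.
by apply/matrixP=> i j; move: (B *m A) => ba; rewrite !mxE; ring.
Qed.

Definition tc v : 'M[F]_n := 1%:M + v *m er iz.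
Definition inV v := (v iy 0 == 0) && (v iz 0 == 0).

Lemma inVP v : reflect (v iy 0 = 0 /\ v iz 0 = 0) (inV v).
Proof. by apply: (iffP andP) => -[/eqP ? /eqP]. Qed.

Lemma tcK v : (tc v - 1%:M) *m ec iz = v.
Proof. by rewrite addrC addKr -mulmxA er_col ec_entry eqxx mulmx1. Qed.

Lemma tc_inj : injective tc.
Proof. by move=> v w E; rewrite -[v]tcK E tcK. Qed.

Lemma tc0 : tc 0 = 1%:M. Proof. by rewrite /tc mul0mx addr0. Qed.

Lemma UT_tc v : v iz 0 = 0 -> is_UT (tc v).
Proof.
move=> vz; apply/is_UTP=> i j le_ji; rewrite mxE [X in X + _]mxE mul_er_entry.
case: (j =P iz) => [ej|]; last by rewrite mulr0 addr0.
suff -> : i = iz by rewrite vz mul0r addr0.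
by apply: ord_inj; move: le_ji; rewrite ej /=; have := ltn_ord i; lia.
Qed.

Lemma tc_add w v : v iz 0 = 0 -> tc w *m tc v = tc (w + v).
Proof.
move=> vz; rewrite /tc !(mulmxDl, mulmxDr, mul1mx, mulmx1) mulmxA -(mulmxA w) er_col.
by rewrite vz raddf0 mulmx0 mul0mx addr0 addrAC addrA.
Qed.

Lemma tc_UT v a : is_UT a -> tc v *m a = a + v *m er iz.
Proof. by move=> Ua; rewrite mulmxDl mul1mx -mulmxA UT_erz. Qed.

(** As [e'_z a = e'_z], conjugating [tc v] by [a] gives [tc (a v)]: the group acts linearly on these
    columns. *)
Lemma comm_tc a v : is_UT a -> v iz 0 = 0 -> comm a (tc v) = tc (a *m v - v).
Proof.
move=> Ua vz; apply: comm_eq; rewrite ?UT_tc // mulmxA tc_add // subrK.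
by rewrite tc_UT // /tc mulmxDr mulmx1 mulmxA.
Qed.

(** If [j] is not [z], compare [x e_jz] with [e_jz x] at [(i, z)]; if [i] is not 1, compare [x e_1i]
    with [e_1i x] at [(1, j)]. *)
Lemma center_entry x i j : is_UT x ->
  (forall a, is_UT a -> x *m a = a *m x) ->
  i != j -> (i != i0) || (j != iz) -> x i j = 0.
Proof.
move=> Ux Cx ne; have lt_jz k : k != iz -> (k < iz)%N.
  by rewrite -val_eqE /= => ?; have := ltn_ord k; lia.
have E k l : (k < l)%N -> x *m delta_mx k l = delta_mx k l *m x.
  move=> lt; have := Cx _ (UT_delta 1 lt).
  by rewrite scale1r mulmxDr mulmxDl mulmx1 mul1mx => /addrI.
case/orP=> [ni|nj]; last first.
  have := congr1 (fun A : 'M_n => A i iz) (E j iz (lt_jz _ nj)).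
  by rewrite mul_delta_entry delta_mul_entry eqxx (negPf ne) mulr1 mul0r.
have lt0i : (i0 < i)%N by move: ni; rewrite -val_eqE /= lt0n.
have := congr1 (fun A : 'M_n => A i0 j) (E i0 i lt0i).
by rewrite mul_delta_entry delta_mul_entry eqxx eq_sym (negPf ne) mul1r mulr0 => <-.
Qed.

Lemma center_form x : is_UT x -> (forall a, is_UT a -> x *m a = a *m x) ->
  x = tc (x i0 iz *: ec i0).
Proof.
move=> Ux Cx; apply/matrixP=> i j; rewrite mxE [X in _ = X + _]mxE mul_er_entry mxE ec_entry.
have [-> | nij] := eqVneq i j.
  rewrite UT_diag // -[LHS]addr0; congr (_ + _); case: (j =P i0) => [-> | _].
    by rewrite mulr0.
  by rewrite mulr0 mul0r.
rewrite mulr0n add0r.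
have [ei | ni] := eqVneq i i0; last by rewrite mulr0 mul0r (center_entry Ux) // ni.
have [-> | nj] := eqVneq j iz; first by rewrite ei !mulr1.
by rewrite mulr0 (center_entry Ux) // nj orbT.
Qed.

Lemma tc_central (c : F) a : is_UT a ->
  tc (c *: ec i0) *m a = a *m tc (c *: ec i0).
Proof.
move=> Ua; apply/esym/(comm_eq1 Ua); last first.
  rewrite comm_tc // -?scalemxAr ?UT_ec0 // ?subrr ?tc0 //.
  by rewrite mxE ec_entry mulr0.
by apply: UT_tc; rewrite mxE ec_entry mulr0.
Qed.

End RankOne.

(** * The action on the last two columns *)

(** The scalar twist below first appears as a bare function; this packs it as a ring morphism. *)
Lemma rmorphism_of_fun (R : pzRingType) (th : R -> R) :
  (forall x y, th (x - y) = th x - th y) -> th 1 = 1 ->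
  (forall x y, th (x * y) = th x * th y) ->
  exists theta : {rmorphism R -> R}, theta =1 th.
Proof.
move=> thB th1 thM.
pose addM := GRing.isZmodMorphism.Build R R th thB.
pose mulM := GRing.isMonoidMorphism.Build R R th (th1, thM).
pose theta : {rmorphism R -> R} := HB.pack th addM mulM.
by exists theta.
Qed.

Section ColumnPart.
Variables (F : fieldType) (m : nat).
Local Notation n := m.+4.
Local Notation i0 := (ix0 m).
Local Notation i1 := (ix1 m).
Local Notation iy := (ixy m).
Local Notation iz := (ixz m).
Local Notation ec := (@ec F m).
Local Notation er := (@er F m).
Local Notation tc := (@tc F m).
Implicit Types (a x y A B : 'M[F]_n) (v s w : 'cV[F]_n) (i j k : 'I_n).

Lemma geq_iy i : (iy <= i)%N -> i = iy \/ i = iz.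
Proof.
move=> le; have lt := ltn_ord i.
have [e|e] : (i : nat) = m.+2 \/ (i : nat) = m.+3 by move: le => /=; lia.
  by left; apply: ord_inj.
by right; apply: ord_inj.
Qed.

Lemma inV_ge v i : inV v -> (iy <= i)%N -> v i 0 = 0.
Proof. by case/inVP=> vy vz /geq_iy[]->. Qed.

Lemma inV_ec k : (k < iy)%N -> inV (ec k).
Proof.
by move=> lt; apply/inVP; rewrite !ec_entry -!val_eqE /= !gtn_eqF //= -ltnS ltnW.
Qed.

Lemma UT_col v k : (forall i, (k <= i)%N -> v i 0 = 0) -> is_UT (1%:M + v *m er k).
Proof.
move=> vk; apply/is_UTP=> i j le_ji; rewrite mxE [X in X + _]mxE mul_er_entry.
case: (j =P k) => [ej|]; last by rewrite mulr0 addr0.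
by rewrite vk ?mul0r ?addr0 // -ej.
Qed.

Definition wc s v := 1%:M + (s *m er iy + v *m er iz).

Lemma UT_wc s v : inV s -> v iz 0 = 0 -> is_UT (wc s v).
Proof.
move=> Vs vz; have [sy sz] := inVP _ Vs.
have -> : wc s v = tc v *m (1%:M + s *m er iy).
  rewrite tc_UT ?/wc ?addrA //; apply: UT_col => i; exact: inV_ge.
by rewrite UT_mul ?UT_tc //; apply: UT_col => i; apply: inV_ge.
Qed.

Lemma wc_mul s v s' v' : inV s' -> v' iz 0 = 0 ->
  (s *m er iy + v *m er iz) *m (s' *m er iy + v' *m er iz) = v' iy 0 *: s *m er iz.
Proof.
move=> /inVP[sy sz] vz; rewrite mulmxDl !mulmxDr !mulmxA -!(mulmxA _ (er _) s').
rewrite -!(mulmxA _ (er _) v') !er_col sy sz vz !raddf0 ?mulmx0 !mul0mx !add0r !addr0.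
by rewrite mul_mx_scalar.
Qed.

(** The nilpotent parts multiply to [v'_y s e'_z] and [v_y s' e'_z], so the commutator sees only
    [s], [s'] and the two [y]-entries. *)
Lemma comm_wc s v s' v' : inV s -> v iz 0 = 0 -> inV s' -> v' iz 0 = 0 ->
  comm (wc s v) (wc s' v') = tc (v' iy 0 *: s - v iy 0 *: s').
Proof.
move=> Vs vz Vs' vz'; have [[sy sz] [sy' sz']] := (inVP _ Vs, inVP _ Vs').
apply: comm_nil; rewrite ?wc_mul //; try exact: UT_wc.
- rewrite mulmxDr !mulmxA -!(mulmxA _ (er _) s) -!(mulmxA _ (er _) v) !er_col sz vz.
  by rewrite !raddf0 ?mulmx0 !mul0mx addr0.
- rewrite mulmxDr !mulmxA -!(mulmxA _ (er _) s') -!(mulmxA _ (er _) v') !er_col sz' vz'.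
  by rewrite !raddf0 ?mulmx0 !mul0mx addr0.
- by rewrite -mulmxDl subrK.
Qed.

Lemma move_entry x k i : (x *m ec k - ec k) i 0 = x i k - (i == k)%:R.
Proof. by rewrite mxE mul_ec [X in _ + X]mxE ec_entry. Qed.

Lemma wc_form x : is_UT x -> (forall k, (k < iy)%N -> x *m ec k = ec k) ->
  x = wc (x *m ec iy - ec iy) (x *m ec iz - ec iz).
Proof.
move=> Ux H; apply/matrixP=> i j; rewrite mxE [X in _ = X + _]mxE [X in _ = _ + X]mxE.
rewrite !mul_er_entry !move_entry.
have [lt|/geq_iy[]->] := ltnP j iy.
- have := congr1 (fun v : 'cV_n => v i 0) (H j lt); rewrite mul_ec ec_entry => ->.
  have /negPf-> : j != iy by rewrite -val_eqE /= ltn_eqF.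
  have /negPf-> : j != iz by rewrite -val_eqE /= ltn_eqF // ltnW // ltnS ltnW.
  by rewrite !mulr0 !addr0 eq_sym.
- have /negPf-> : iy != iz by rewrite -val_eqE /= ltn_eqF.
  by rewrite eqxx mulr0 addr0 mulr1 addrC subrK.
- have /negPf-> : iz != iy by rewrite -val_eqE /= gtn_eqF.
  by rewrite eqxx mulr0 add0r mulr1 addrC subrK.
Qed.

Lemma UT_move_y a : is_UT a -> inV (a *m ec iy - ec iy).
Proof.
move=> Ua; apply/inVP; rewrite !move_entry eqxx UT_diag // subrr (UT_low Ua) //.
by rewrite -val_eqE /= gtn_eqF // subrr.
Qed.

Lemma UT_move a v : is_UT a -> inV v -> inV (a *m v - v).
Proof.
move=> Ua /inVP[vy vz]; apply/inVP; rewrite mxE [X in _ + X]mxE.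
rewrite UT_mul_entry_y // subrr mxE [X in _ + X]mxE.
by rewrite UT_mul_entry_z // subrr.
Qed.

Lemma inVB v w : inV v -> inV w -> inV (v - w).
Proof.
by move=> /inVP[vy vz] /inVP[wy wz]; apply/inVP; rewrite !mxE vy vz wy wz subrr.
Qed.

Lemma inVZ (c : F) v : inV v -> inV (c *: v).
Proof. by move=> /inVP[vy vz]; apply/inVP; rewrite !mxE vy vz mulr0. Qed.

Lemma inV0 : inV (0 : 'cV[F]_n).
Proof. by apply/inVP; rewrite !mxE. Qed.

Variable phi : 'M[F]_n -> 'M[F]_n.
Hypothesis PC : PC_map phi.
Hypothesis phit : phi (tc (ec iy)) = tc (ec iy).

Let ecyz : ec iy iz 0 = 0.
Proof. by rewrite ec_entry -val_eqE /= gtn_eqF. Qed.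

(** The bijection [f] of [V], written as a total function; [phi_tc] gives [phi (tc v) = tc (fc v)]
    only for [v] in [V]. *)
Definition fc v : 'cV[F]_n := (phi (tc v) - 1%:M) *m ec iz.

(** Both sides come from the commutator of [a] with the fixed element [tc (ec iy)]. *)
Lemma phi_tc_move a : is_UT a ->
  phi (tc (a *m ec iy - ec iy)) = tc (phi a *m ec iy - ec iy).
Proof.
move=> Ua; rewrite -!comm_tc ?PC_comm ?UT_tc ?phit //; exact: PC_UT.
Qed.

Lemma tc_as_move v : inV v -> exists2 a, is_UT a & a *m ec iy - ec iy = v.
Proof.
move=> Vv; exists (1%:M + v *m er iy); first by apply: UT_col => i; apply: inV_ge.
by rewrite mulmxDl mul1mx -mulmxA er_col ec_entry eqxx mulmx1 addrC addKr.
Qed.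

Lemma phi_tc v : inV v -> phi (tc v) = tc (fc v).
Proof.
by case/tc_as_move=> a Ua <-; rewrite /fc phi_tc_move // tcK.
Qed.

Lemma fc_inV v : inV v -> inV (fc v).
Proof.
case/tc_as_move=> a Ua <-; rewrite /fc phi_tc_move // tcK.
by apply/UT_move_y/PC_UT.
Qed.

Lemma fc_move_y a : is_UT a -> fc (a *m ec iy - ec iy) = phi a *m ec iy - ec iy.
Proof. by move=> Ua; rewrite /fc phi_tc_move // tcK. Qed.

Lemma fc_move a v : is_UT a -> inV v -> fc (a *m v - v) = phi a *m fc v - fc v.
Proof.
move=> Ua Vv; have [vy vz] := inVP _ Vv; have [fy fz] := inVP _ (fc_inV Vv).
apply: tc_inj; rewrite -phi_tc ?UT_move // -comm_tc // PC_comm ?UT_tc //.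
by rewrite phi_tc // comm_tc // PC_UT.
Qed.

Lemma fc_surj w : inV w -> exists2 v, inV v & fc v = w.
Proof.
case/tc_as_move=> b /(PC_surj PC)[a Ua <-] <-.
by exists (a *m ec iy - ec iy); [apply: UT_move_y | rewrite fc_move_y].
Qed.

Lemma fc0 : fc 0 = 0.
Proof. by rewrite /fc tc0 PC_1 // subrr mul0mx. Qed.

Lemma fc_inj v w : inV v -> inV w -> fc v = fc w -> v = w.
Proof.
move=> Vv Vw E; apply: tc_inj; case: (PC) => _ inj _ _; apply: inj.
- by apply: UT_tc; case/inVP: Vv.
- by apply: UT_tc; case/inVP: Vw.
- by rewrite !phi_tc // E.
Qed.

(** A test element with freely prescribed values for the two data that enter [comm_wc]. The entry
    [gc] of its image may a priori depend on both; [gcE] separates the two dependences. *)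
Definition xc s (c : F) := wc s (c *: ec iy).
Definition gc s (c : F) := phi (xc s c) iy iz.

Let cyz c : (c *: ec iy) iz 0 = 0.
Proof. by rewrite mxE ecyz mulr0. Qed.

Let cyy c : (c *: ec iy) iy 0 = c.
Proof. by rewrite mxE ec_entry eqxx mulr1. Qed.

Lemma UT_xc s c : inV s -> is_UT (xc s c).
Proof. by move=> Vs; apply: UT_wc. Qed.

Lemma xc_ecy s c : inV s -> xc s c *m ec iy - ec iy = s.
Proof.
move=> Vs; rewrite mulmxDl mul1mx mulmxDl -!mulmxA !er_col !ec_entry eqxx.
by rewrite [iz == _]gtn_eqF // mulmx1 raddf0 ?mulmx0 addr0 addrC addKr.
Qed.

Lemma xc_tc s c v : inV s -> inV v -> xc s c *m tc v = tc v *m xc s c.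
Proof.
move=> Vs Vv; have [vy vz] := inVP _ Vv.
apply/comm_eq1; rewrite ?UT_tc ?UT_xc // comm_tc ?UT_xc //.
rewrite mulmxDl mul1mx addrC addKr mulmxDl -!mulmxA !er_col vy vz !raddf0 ?mulmx0 addr0.
exact: tc0.
Qed.

(** [xc s c] commutes with every [tc v], [v] in [V], so its image fixes every [fc v]; by
    surjectivity of [fc] it fixes each [ec k] with [k < iy], and [wc_form] applies. *)
Lemma phi_xc s c : inV s -> exists v, [/\ v iz 0 = 0, v iy 0 = gc s c &
  phi (xc s c) = wc (fc s) v].
Proof.
move=> Vs; have Ux := UT_xc c Vs; have Up := PC_UT PC Ux.
exists (phi (xc s c) *m ec iz - ec iz); split.
- by rewrite move_entry UT_diag // eqxx subrr.
- by rewrite move_entry -val_eqE /= ltn_eqF // subr0.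
rewrite -[in fc s](xc_ecy c Vs) fc_move_y //; apply: wc_form => // k lt.
have Vk : inV (ec k) by apply: inV_ec.
have [v Vv Ev] := fc_surj Vk; have [vy vz] := inVP _ Vv.
have /(PC_commute PC) E := xc_tc c Vs Vv.
have := E Ux (UT_tc vz); rewrite phi_tc // Ev => /comm_eq1.
rewrite comm_tc //; last by case/inVP: Vk.
rewrite UT_tc; last by case/inVP: Vk.
by move=> /(_ Up isT); rewrite -tc0 => /tc_inj/eqP; rewrite subr_eq0 => /eqP.
Qed.

(* The bilinear commutator pairing on the last two columns: this single identity
   yields additivity of both [fc] and the field automorphism. *)
Lemma fc_gc s c s' c' : inV s -> inV s' ->
  fc (c' *: s - c *: s') = gc s' c' *: fc s - gc s c *: fc s'.
Proof.
move=> Vs Vs'; have [v [vz vy Ev]] := phi_xc c Vs; have [v' [vz' vy' Ev']] := phi_xc c' Vs'.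
apply: tc_inj; rewrite -phi_tc ?inVB ?inVZ // -vy -vy' -comm_wc ?fc_inV // -Ev -Ev'.
by rewrite -PC_comm ?UT_xc // comm_wc // !cyy.
Qed.

Definition thc c := gc 0 c.

Lemma fcZ c s : inV s -> fc (c *: s) = thc c *: fc s.
Proof.
move=> Vs; have := fc_gc 0 c Vs inV0.
by rewrite fc0 !scaler0 !subr0.
Qed.

Let V0 : inV (ec i0).
Proof. exact: inV_ec. Qed.

Let fc_neq0 s : inV s -> s != 0 -> fc s != 0.
Proof.
by move=> Vs; apply: contraNneq => E; apply/eqP/fc_inj; rewrite ?inV0 ?fc0.
Qed.

(** Evaluate [fc ((c' - c) *: s)] by [fcZ] and by [fc_gc] with [s' = s], then cancel the nonzero
    column [fc s]. *)
Let gc_diff s c c' : inV s -> s != 0 -> thc (c' - c) = gc s c' - gc s c.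
Proof.
move=> Vs s0; have := fc_gc c c' Vs Vs.
rewrite -scalerBl fcZ // -scalerBl => /eqP; rewrite -subr_eq0 -scalerBl scaler_eq0.
by rewrite (negPf (fc_neq0 Vs s0)) orbF subr_eq0 => /eqP.
Qed.

Let ec0_neq0 : ec i0 != 0.
Proof.
apply/eqP=> /(congr1 (fun v : 'cV_n => v i0 0)) /eqP.
by rewrite ec_entry mxE eqxx oner_eq0.
Qed.

Lemma thcB c c' : thc (c' - c) = thc c' - thc c.
Proof.
rewrite (gc_diff _ _ V0) // -{2}(subr0 c') -{2}(subr0 c) !(gc_diff _ _ V0) //; ring.
Qed.

Lemma thcM c c' : thc (c * c') = thc c * thc c'.
Proof.
have := fcZ (c * c') V0; rewrite -scalerA fcZ ?inVZ // fcZ // scalerA.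
move/eqP; rewrite -subr_eq0 -scalerBl scaler_eq0 (negPf (fc_neq0 V0 _)) //.
by rewrite orbF subr_eq0 => /eqP.
Qed.

Lemma thc1 : thc 1 = 1.
Proof.
rewrite /thc /gc /xc /wc mul0mx add0r scale1r phit.
rewrite mxE [X in X + _]mxE mul_er_entry ec_entry !eqxx mulr1.
by rewrite -val_eqE /= ltn_eqF // add0r.
Qed.

Lemma thc0 : thc 0 = 0.
Proof. by have := thcB 0 0; rewrite !subrr. Qed.

Let gcE s c : inV s -> gc s c = thc c + gc s 0.
Proof.
move=> Vs; have [-> | s0] := eqVneq s 0; first by rewrite -!/(thc _) thc0 addr0.
by rewrite -{2}(subr0 c) (gc_diff _ _ Vs) // subrK.
Qed.

(** By [gcE], the coefficients in [fc_gc] are [thc] plus offsets [gc s 0] and [gc s' 0]; the offsets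
    contribute exactly the case [c = c' = 0] of [fc_gc], which is zero. *)
Lemma fc_semilinear s c s' c' : inV s -> inV s' ->
  fc (c' *: s - c *: s') = thc c' *: fc s - thc c *: fc s'.
Proof.
move=> Vs Vs'; rewrite fc_gc // (gcE c' Vs') (gcE c Vs).
have := fc_gc 0 0 Vs Vs'; rewrite !scale0r subrr fc0 => E.
by rewrite !scalerDl opprD addrACA -E addr0.
Qed.

Lemma fcD s s' : inV s -> inV s' -> fc (s + s') = fc s + fc s'.
Proof.
move=> Vs Vs'; have := fc_semilinear (-1) 1 Vs Vs'.
rewrite !scale1r scaleN1r opprK thc1 scale1r => ->.
by rewrite -(sub0r 1) thcB thc0 thc1 sub0r scaleN1r opprK.
Qed.

Let phi_central x : is_UT x -> (forall a, is_UT a -> x *m a = a *m x) ->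
  forall a, is_UT a -> phi x *m a = a *m phi x.
Proof.
by move=> Ux Cx _ /(PC_surj PC)[a Ua <-]; apply/(PC_commute PC) => //; apply: Cx.
Qed.

Let ctc c : is_UT (tc (c *: ec i0)).
Proof. by apply: UT_tc; rewrite mxE ec_entry mulr0. Qed.

Let fc_ec0 : exists2 c, fc (ec i0) = c *: ec i0 & c != 0.
Proof.
have Uc := ctc 1; have Cc := tc_central (1 : F).
have := center_form (PC_UT PC Uc) (phi_central Uc (@Cc m)).
rewrite scale1r phi_tc // => /tc_inj.
set c := (X in X *: _) => E; exists c => //.
by have := fc_neq0 V0 ec0_neq0; rewrite E; apply: contraNneq => ->; rewrite scale0r.
Qed.

(** The centre is preserved in both directions, so [tc ((c * k) *: ec i0)] has a central preimage
    [tc (d *: ec i0)], and [thc d * k = c * k]. Boolean equality lets [xchoose] select [d]. *)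
Lemma thc_surj c : exists d, thc d == c.
Proof.
have [k Ek k0] := fc_ec0.
have [x Ux Ex] := PC_surj PC (ctc (c * k)).
have Cx a : is_UT a -> x *m a = a *m x.
  by move=> Ua; apply/(PC_commute PC) => //; rewrite Ex tc_central // PC_UT.
have := Ex; rewrite (center_form Ux Cx) phi_tc ?inVZ // => /tc_inj.
rewrite fcZ // Ek scalerA => /(congr1 (fun v : 'cV_n => v i0 0)).
rewrite !mxE !eqxx !mulr1 => /(mulIf k0) E.
by exists (x i0 iz); apply/eqP.
Qed.

Lemma UT_move_low (b : 'M[F]_n) w (k : nat) : is_UT b ->
  (forall l : 'I_n, (k < l)%N -> w l 0 = 0) ->
  forall i : 'I_n, (k <= i)%N -> (b *m w - w) i 0 = 0.
Proof.
move=> Ub wk i le_ki; rewrite mxE [X in _ + X]mxE mxE (bigD1 i) //= UT_diag // mul1r.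
rewrite big1 ?addr0 ?subrr // => l ne.
have [lt|le] := ltnP l i; first by rewrite (UT_low Ub) ?mul0r.
rewrite wk ?mulr0 //; apply: leq_ltn_trans le_ki _.
by rewrite ltn_neqAle le eq_sym ne.
Qed.

(** Downward induction on [k]: [e_k] is the move of [e_(k+1)] under [1 + e_k e'_(k+1)], so
    [fc (ec k)] is a unipotent move of [fc (ec k')], or of [e_y] itself when [k' = iy]. Each such
    move clears the lowest possible nonzero entry. *)
Lemma fc_ec_low k i : (k < iy)%N -> (k < i)%N -> fc (ec k) i 0 = 0.
Proof.
have [d] := ubnP (iy - k); elim: d k i => // d IH k i led lt_ky lt_ki.
have lt_k1 : (k.+1 < n)%N by move: lt_ky => /=; lia.
pose k' := Ordinal lt_k1.
have Ua : is_UT (1%:M + ec k *m er k').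
  by apply: UT_col => l le; rewrite ec_entry -val_eqE gtn_eqF.
have Ea : (1%:M + ec k *m er k') *m ec k' - ec k' = ec k.
  by rewrite mulmxDl mul1mx -mulmxA er_col ec_entry eqxx mulmx1 addrC addKr.
have Ub := PC_UT PC Ua.
rewrite -Ea; have [eky | neq] := eqVneq k' iy.
  rewrite eky fc_move_y; last by rewrite -eky.
  apply: (@UT_move_low _ _ k.+1) => //; first by rewrite -eky.
  by move=> l lt; rewrite ec_entry -val_eqE gtn_eqF // -eky.
have lt' : (k' < iy)%N.
  by rewrite ltn_neqAle lt_ky andbT -val_eqE in neq *.
rewrite fc_move ?inV_ec //; apply: (@UT_move_low _ _ k.+1) => // l lt.
by apply: IH => //; move: led lt' => /=; lia.
Qed.

(** The matrix of the semilinear map [fc] on [V], completed by the last two standard columns so that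
    it fixes [e_y]. *)
Definition mc : 'M[F]_n :=
  \matrix_(i, j) if (j < iy)%N then fc (ec j) i 0 else (i == j)%:R.

Lemma mc_upper i j : (j < i)%N -> mc i j = 0.
Proof.
move=> lt; rewrite mxE; case: ifP => [lt'|_]; first exact: fc_ec_low.
by rewrite -val_eqE gtn_eqF.
Qed.

Lemma mc_low i j : (iy <= i)%N -> mc i j = (i == j)%:R.
Proof.
move=> le; rewrite mxE; case: ifP => // lt; rewrite inV_ge ?fc_inV ?inV_ec //.
by rewrite -val_eqE gtn_eqF // (leq_trans lt).
Qed.

Lemma mc_ecy : mc *m ec iy = ec iy.
Proof.
by apply/matrixP=> i j; rewrite [j]ord1 mul_ec ec_entry mxE ltnn.
Qed.

Lemma mc_erz : er iz *m mc = er iz.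
Proof.
apply/matrixP=> i j; rewrite [i]ord1 er_mul er_entry mc_low /= //.
by rewrite eq_sym.
Qed.

Lemma inV_sum v : inV v -> v = \sum_(k < n | (k < iy)%N) v k 0 *: ec k.
Proof.
move=> Vv; apply/matrixP=> i j; rewrite [j]ord1 summxE.
have [lt|le] := ltnP i iy.
  rewrite (bigD1 i) //= big1 ?addr0 => [|k /andP[_ ne]].
    by rewrite mxE ec_entry eqxx mulr1.
  by rewrite mxE ec_entry eq_sym (negPf ne) mulr0.
rewrite inV_ge // big1 // => k lt; rewrite mxE ec_entry -val_eqE gtn_eqF ?mulr0 //.
exact: leq_trans lt le.
Qed.

Variable theta : {rmorphism F -> F}.
Hypothesis thetaE : theta =1 thc.

Lemma fc_mc v : inV v -> fc v = mc *m map_mx theta v.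
Proof.
move=> Vv; have -> : fc v = \sum_(k < n | (k < iy)%N) theta (v k 0) *: fc (ec k).
  rewrite {1}(inV_sum Vv).
  (* Membership in [V] is carried through the sum, because [fcD] and [fcZ] hold only there. *)
  pose K (u w : 'cV[F]_n) := inV u /\ fc u = w.
  suff [] : K (\sum_(k < n | (k < iy)%N) v k 0 *: ec k)
              (\sum_(k < n | (k < iy)%N) theta (v k 0) *: fc (ec k)) by [].
  apply: (big_ind2 K); first by split; rewrite ?inV0 ?fc0.
    move=> u w u' w' [Vu <-] [Vu' <-]; split; last by rewrite fcD.
    by rewrite -[u']opprK inVB // -sub0r inVB // inV0.
  by move=> k lt; split; rewrite ?fcZ ?inVZ ?inV_ec ?thetaE.
apply/matrixP=> i j; rewrite [j]ord1 summxE [RHS]mxE.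
rewrite [RHS](bigID (fun k : 'I_n => (k < iy)%N)) /=.
rewrite [X in _ = _ + X]big1 ?addr0 => [|k]; last first.
  by rewrite -leqNgt => le; rewrite [map_mx _ _ _ _]mxE inV_ge // rmorph0 mulr0.
by apply: eq_bigr => k lt; rewrite !mxE lt mulrC.
Qed.

(** A kernel column vanishes at [y] and [z] by [mc_low]. Since [theta] is onto, it is [theta]
    applied to some [u] in [V]; then [fc u = 0], and injectivity of [fc] gives [u = 0]. *)
Lemma mc_unit : mc \in unitmx.
Proof.
rewrite -unitmx_tr -row_free_unit; apply: inj_row_free => w Ew.
have {}Ew : mc *m w^T = 0.
  by rewrite -[mc]trmxK -trmx_mul Ew trmx0.
have low i : (iy <= i)%N -> w^T i 0 = 0.
  move=> le; have := congr1 (fun v : 'cV_n => v i 0) Ew; rewrite mxE (bigD1 i) //=.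
  rewrite mc_low // eqxx mul1r big1 ?addr0 ?mxE // => k ne.
  by rewrite mc_low // eq_sym (negPf ne) mul0r.
pose th' c := xchoose (thc_surj c).
have th'K c : theta (th' c) = c by rewrite thetaE; apply/eqP/(xchooseP (thc_surj c)).
pose u := map_mx th' w^T.
have Eu : map_mx theta u = w^T by apply/matrixP=> i j; rewrite !mxE th'K.
have th'0 : th' 0 = 0 by apply: (fmorph_inj theta); rewrite th'K rmorph0.
have Vu : inV u by apply/inVP; split; rewrite mxE low ?th'0.
have u0 : u = 0.
  by apply: fc_inj => //; [apply: inV0 | rewrite fc0 fc_mc // Eu].
by rewrite -[w]trmxK -Eu u0 raddf0 trmx0.
Qed.

End ColumnPart.

Section ColumnNormalForm.
Variables (F : fieldType) (m : nat).

Lemma column_normal_form (phi : 'M[F]_m.+4 -> 'M[F]_m.+4) : PC_map phi ->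
  phi (tc (ec F (ixy m))) = tc (ec F (ixy m)) ->
  exists (M : 'M[F]_m.+4) (theta theta' : {rmorphism F -> F}),
    [/\ is_T M, cancel theta theta' /\ cancel theta' theta,
        M *m ec F (ixy m) = ec F (ixy m), er F (ixz m) *m M = er F (ixz m) &
        forall v, inV v -> phi (tc v) = tc (M *m map_mx theta v)].
Proof.
move=> PC phit.
have [theta thetaE] := rmorphism_of_fun (fun x y => thcB PC phit y x) (thc1 phit)
  (thcM PC phit).
(* Chosen preimages form the inverse of [theta]; its morphism laws follow from injectivity of field
   morphisms. *)
pose th' c := xchoose (thc_surj PC phit c).
have th'K : cancel th' theta.
  by move=> c; rewrite thetaE; apply/eqP/(xchooseP (thc_surj PC phit c)).
have [||| theta' theta'E] := @rmorphism_of_fun F th'.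
- by move=> x y; apply: (fmorph_inj theta); rewrite rmorphB !th'K.
- by apply: (fmorph_inj theta); rewrite rmorph1 th'K.
- by move=> x y; apply: (fmorph_inj theta); rewrite rmorphM !th'K.
exists (mc phi), theta, theta'; split.
- apply/is_TP; split; [exact: mc_upper | exact: mc_unit thetaE].
- split=> c; last by rewrite theta'E th'K.
  by apply: (fmorph_inj theta); rewrite theta'E th'K.
- exact: mc_ecy.
- exact: mc_erz.
- by move=> v Vv; rewrite phi_tc // (fc_mc PC phit thetaE Vv).
Qed.

End ColumnNormalForm.

(** * The action on the first two rows *)

Section RowElements.
Variables (F : fieldType) (m : nat).
Local Notation n := m.+4.
Local Notation i0 := (ix0 m).
Local Notation i1 := (ix1 m).
Local Notation iy := (ixy m).
Local Notation iz := (ixz m).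
Local Notation ec := (@ec F m).
Local Notation er := (@er F m).
Local Notation tc := (@tc F m).
Implicit Types (a x y A B : 'M[F]_n) (r s w : 'rV[F]_n) (i j k : 'I_n) (c d : F).

Definition lr r : 'M[F]_n := 1%:M + ec i0 *m r.
Definition inU r := (r 0 i0 == 0) && (r 0 i1 == 0).

Lemma inUP r : reflect (r 0 i0 = 0 /\ r 0 i1 = 0) (inU r).
Proof. by apply: (iffP andP) => -[/eqP ? /eqP]. Qed.

Lemma leq_i1 j : (j <= i1)%N -> j = i0 \/ j = i1.
Proof.
move=> le; have [e|e] : (j : nat) = 0%N \/ (j : nat) = 1%N by move: le => /=; lia.
  by left; apply: ord_inj.
by right; apply: ord_inj.
Qed.

Lemma inU_le r j : inU r -> (j <= i1)%N -> r 0 j = 0.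
Proof. by case/inUP=> r0 r1 /leq_i1[]->. Qed.

Lemma inU_er k : (i1 < k)%N -> inU (er k).
Proof.
by move=> lt; apply/inUP; rewrite !er_entry -!val_eqE /= !ltn_eqF //= ltnW.
Qed.

Lemma inU_lin c d r s : inU r -> inU s -> inU (c *: r - d *: s).
Proof.
by move=> /inUP[r0 r1] /inUP[s0 s1]; apply/inUP; rewrite !mxE r0 r1 s0 s1 !mulr0 subrr.
Qed.

Lemma inU0 : inU 0.
Proof. by apply/inUP; rewrite !mxE. Qed.

Lemma inUD r s : inU r -> inU s -> inU (r + s).
Proof. by move=> Ur Us; have := inU_lin 1 (-1) Ur Us; rewrite scale1r scaleN1r opprK. Qed.

Lemma UT_row r k : (forall j, (j <= k)%N -> r 0 j = 0) -> is_UT (1%:M + ec k *m r).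
Proof.
move=> rk; apply/is_UTP=> i j le_ji; rewrite mxE [X in X + _]mxE ec_mul_entry.
case: (i =P k) => [ei|]; last by rewrite mul0r addr0.
by rewrite rk ?mulr0 ?addr0 // -ei.
Qed.

Lemma lrK r : er i0 *m (lr r - 1%:M) = r.
Proof. by rewrite addrC addKr mulmxA er_col ec_entry eqxx mul1mx. Qed.

Lemma lr_inj : injective lr.
Proof. by move=> v w E; rewrite -[v]lrK E lrK. Qed.

Lemma UT_lr r : r 0 i0 = 0 -> is_UT (lr r).
Proof.
move=> r0; apply: UT_row => j le; suff -> : j = i0 by [].
by apply: ord_inj; move: le => /=; lia.
Qed.

Lemma lr_add w r : w 0 i0 = 0 -> lr w *m lr r = lr (w + r).
Proof.
move=> wz; rewrite /lr !(mulmxDl, mulmxDr, mul1mx, mulmx1) mulmxA -(mulmxA _ w) row_ec.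
by rewrite wz raddf0 ?mulmx0 mul0mx addr0 addrAC addrA.
Qed.

Lemma UT_mul_lr r a : is_UT a -> a *m lr r = a + ec i0 *m r.
Proof. by move=> Ua; rewrite mulmxDr mulmx1 mulmxA UT_ec0. Qed.

Lemma row_UT_entry0 r a : is_UT a -> (r *m a) 0 i0 = r 0 i0.
Proof.
move=> Ua; have := congr1 (fun u : 'M_1 => u 0 0) (row_ec i0 (r *m a)).
by rewrite -mulmxA UT_ec0 // row_ec !mxE /= !mulr1n => ->.
Qed.

Lemma row_UT_entry1 r a : is_UT a -> r 0 i0 = 0 -> (r *m a) 0 i1 = r 0 i1.
Proof.
move=> Ua r0; rewrite mxE (bigD1 i1) //= UT_diag // mulr1 big1 ?addr0 // => k ne.
have [lt|le] := ltnP i1 k; first by rewrite (UT_low Ua) ?mulr0.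
by case: (leq_i1 le) => E; rewrite E ?r0 ?mul0r // E eqxx in ne *.
Qed.

(** Mirror of [comm_tc]: here [a e_1 = e_1], and conjugation acts on rows from the right by the
    inverse. *)
Lemma comm_lr a r : is_UT a -> r 0 i0 = 0 -> comm a (lr r) = lr (r *m invmx a - r).
Proof.
move=> Ua r0; apply: comm_eq; rewrite ?UT_lr // mulmxA lr_add ?subrK.
  by rewrite UT_mul_lr // mulmxDl mul1mx -mulmxA mulmxKV // UT_unit.
by rewrite mxE [X in _ + X]mxE row_UT_entry0 ?UT_inv // subrr.
Qed.

Lemma inU_move a r : is_UT a -> inU r -> inU (r *m invmx a - r).
Proof.
move=> Ua /inUP[r0 r1]; apply/inUP; rewrite mxE [X in _ + X]mxE.
rewrite row_UT_entry0 ?UT_inv // subrr mxE [X in _ + X]mxE.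
by rewrite row_UT_entry1 ?UT_inv // subrr.
Qed.

Lemma commute_lr a r : is_UT a -> r 0 i0 = 0 ->
  a *m lr r = lr r *m a <-> r *m a = r.
Proof.
move=> Ua r0; rewrite UT_mul_lr // /lr mulmxDl mul1mx -mulmxA.
split=> [/addrI E | -> //].
by have := lrK (r *m a); rewrite /lr -E -/(lr r) lrK.
Qed.

Definition wr s r := 1%:M + (ec i0 *m s + ec i1 *m r).

Lemma UT_wr s r : s 0 i0 = 0 -> inU r -> is_UT (wr s r).
Proof.
move=> s0 Ur; have -> : wr s r = (1%:M + ec i1 *m r) *m lr s.
  rewrite UT_mul_lr ?/wr -?addrA 1?[X in _ + X]addrC //.
  by apply: UT_row => j; apply: inU_le.
by rewrite UT_mul ?UT_lr //; apply: UT_row => j; apply: inU_le.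
Qed.

Lemma wr_mul s r s' r' : s 0 i0 = 0 -> inU r ->
  (ec i0 *m s + ec i1 *m r) *m (ec i0 *m s' + ec i1 *m r') = ec i0 *m (s 0 i1 *: r').
Proof.
move=> s0 /inUP[r0 r1]; rewrite mulmxDl !mulmxDr !mulmxA -!(mulmxA _ s (ec _)).
rewrite -!(mulmxA _ r (ec _)) !row_ec s0 r0 r1 !raddf0 ?mulmx0 !mul0mx add0r !addr0.
by rewrite mul_mx_scalar -scalemxAl scalemxAr.
Qed.

Lemma comm_wr s r s' r' : s 0 i0 = 0 -> inU r -> s' 0 i0 = 0 -> inU r' ->
  comm (wr s r) (wr s' r') = lr (s 0 i1 *: r' - s' 0 i1 *: r).
Proof.
move=> s0 Ur s0' Ur'.
have /inUP[w0 w1] : inU (s 0 i1 *: r' - s' 0 i1 *: r) by apply: inU_lin.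
apply: comm_nil; rewrite ?wr_mul //; try exact: UT_wr.
- rewrite mulmxDr !mulmxA -!(mulmxA _ _ (ec _)) !row_ec w0 w1.
  by rewrite !raddf0 ?mulmx0 !mul0mx addr0.
- rewrite mulmxDr !mulmxA -!(mulmxA _ _ (ec _)) !row_ec w0 w1.
  by rewrite !raddf0 ?mulmx0 !mul0mx addr0.
- by rewrite -mulmxDr subrK.
Qed.

Lemma lr_entry r i j : lr r i j = (i == j)%:R + (i == i0)%:R * r 0 j.
Proof. by rewrite mxE [X in X + _]mxE ec_mul_entry. Qed.

Lemma wr_entry s r i j :
  wr s r i j = (i == j)%:R + ((i == i0)%:R * s 0 j + (i == i1)%:R * r 0 j).
Proof. by rewrite mxE [X in X + _]mxE [X in _ + X]mxE !ec_mul_entry. Qed.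

Lemma lr_erz : lr (er iz) = tc (ec i0). Proof. by []. Qed.

End RowElements.

(** * The linear form on rows left once the columns are fixed *)

Section RowPart.
Variables (F : fieldType) (m : nat).
Local Notation n := m.+4.
Local Notation i0 := (ix0 m).
Local Notation i1 := (ix1 m).
Local Notation iy := (ixy m).
Local Notation iz := (ixz m).
Local Notation ec := (@ec F m).
Local Notation er := (@er F m).
Local Notation tc := (@tc F m).
Local Notation lr := (@lr F m).
Implicit Types (a x y A B : 'M[F]_n) (r s w : 'rV[F]_n) (i j k : 'I_n) (c d : F).

Variable phi : 'M[F]_n -> 'M[F]_n.
Hypothesis PC : PC_map phi.
Hypothesis phit : phi (tc (ec iy)) = tc (ec iy).
Hypothesis phiV : forall v, inV v -> phi (tc v) = tc v.
Variable r1 : 'rV[F]_n.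
Hypothesis phit1 : phi (lr (er i1)) = lr r1.

(** Column [j] of [a] is read off the commutator of [a] with [tc (ec j)]; that commutator and
    [tc (ec j)] itself are fixed by [phi]. *)
Lemma phi_columns a i j : is_UT a -> j != iz -> phi a i j = a i j.
Proof.
move=> Ua nj; suff E : phi a *m ec j - ec j = a *m ec j - ec j.
  by have := congr1 (fun v : 'cV_n => v i 0) E; rewrite !move_entry => /addIr.
have [lt|/geq_iy[ej|ej]] := ltnP j iy; last by rewrite ej eqxx in nj.
  have Vj := inV_ec F lt; have [jy jz] := inVP _ Vj.
  apply: (@tc_inj F m); rewrite -comm_tc ?PC_UT // -(phiV Vj) -PC_comm ?UT_tc //.
  by rewrite comm_tc // phiV // UT_move.
by rewrite ej; apply: (@tc_inj F m); rewrite -phi_tc_move // phiV // UT_move_y.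
Qed.

Let r10 : r1 0 i0 = 0.
Proof.
have U1 : is_UT (lr (er i1)) by apply: UT_lr; rewrite er_entry.
have := UT_diag i0 (PC_UT PC U1); rewrite phit1 lr_entry eqxx mul1r -[RHS]addr0.
by move/addrI.
Qed.

Let UT_t1 : is_UT (lr (er i1)).
Proof. by apply: UT_lr; rewrite er_entry. Qed.

Let r1E : r1 = er i1 + r1 0 iz *: er iz.
Proof.
apply/matrixP=> i j; rewrite [i]ord1 mxE er_entry mxE er_entry.
have [-> | nj] := eqVneq j iz.
  by rewrite mulr1 -val_eqE /= add0r.
rewrite mulr0 addr0; have := phi_columns i0 UT_t1 nj.
by rewrite phit1 !lr_entry eqxx !mul1r er_entry => /addrI.
Qed.

(** By [r1E], [r1] differs from [e'_2] by a multiple of [e'_z], which unitriangular matrices fix, so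
    the difference drops out of the move. *)
Lemma phi_lr_move a : is_UT a ->
  phi (lr (er i1 *m invmx a - er i1)) = lr (er i1 *m invmx (phi a) - er i1).
Proof.
move=> Ua; have Up := PC_UT PC Ua.
rewrite -comm_lr ?er_entry // PC_comm // phit1 comm_lr //.
congr lr; rewrite {1}r1E mulmxDl -scalemxAl UT_erz ?UT_inv // {2}r1E.
by rewrite opprD addrACA subrr addr0.
Qed.

Lemma lr_as_move r : inU r -> exists2 a, is_UT a & er i1 *m invmx a - er i1 = r.
Proof.
move=> Ur; have Ub : is_UT (1%:M + ec i1 *m r) by apply: UT_row => j; apply: inU_le.
exists (invmx (1%:M + ec i1 *m r)); first exact: UT_inv.
by rewrite invmxK mulmxDr mulmx1 mulmxA er_col ec_entry eqxx mul1mx addrC addKr.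
Qed.

(** For [r] in [inU], the deviation of [phi (lr r)] from [lr r]: only the corner entry can
    change. *)
Definition rho r := phi (lr r) i0 iz - r 0 iz.

Lemma phi_lr r : inU r -> phi (lr r) = lr (r + rho r *: er iz).
Proof.
move=> Ur; have [u0 u1] := inUP _ Ur.
have [r' E] : exists r', phi (lr r) = lr r'.
  by case/lr_as_move: Ur => a Ua <-; eexists; apply: phi_lr_move.
rewrite E; congr lr; apply/matrixP=> i j; rewrite [i]ord1 [RHS]mxE [X in _ = _ + X]mxE.
rewrite er_entry /rho E; have [-> | nj] := eqVneq j iz.
  by rewrite mulr1 lr_entry eqxx mul1r -val_eqE /= add0r addrC subrK.
rewrite mulr0 addr0; have := phi_columns i0 (UT_lr u0) nj.
by rewrite E !lr_entry eqxx !mul1r => /addrI.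
Qed.

Definition yr c r := wr (c *: er i1) r.
Definition qr c r := phi (yr c r) i1 iz - r 0 iz.

Let cs0 c : (c *: er i1) 0 i0 = 0. Proof. by rewrite mxE er_entry mulr0. Qed.
Let cs1 c : (c *: er i1) 0 i1 = c. Proof. by rewrite mxE er_entry eqxx mulr1. Qed.

(** By [phi_columns] only the last column can change. In row [i] beyond the second it does not:
    [yr c r] commutes with [lr (er i)], so its image fixes [er i]. *)
Lemma phi_yr c r : inU r -> exists d,
  phi (yr c r) = wr (c *: er i1 + d *: er iz) (r + qr c r *: er iz).
Proof.
move=> Ur; have UY : is_UT (yr c r) by apply: UT_wr.
have UpY := PC_UT PC UY.
exists (phi (yr c r) i0 iz); apply/matrixP=> i j; rewrite wr_entry.
have [-> | nj] := eqVneq j iz; last first.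
  rewrite phi_columns // wr_entry; congr (_ + (_ * _ + _ * _)).
    by rewrite [RHS]mxE [X in _ + X]mxE er_entry (negPf nj) mulr0 addr0.
  by rewrite [RHS]mxE [X in _ + X]mxE er_entry (negPf nj) mulr0 addr0.
have [lt|/leq_i1[]->] := ltnP i1 i; last 2 first.
- rewrite eqxx mul1r mul0r addr0 add0r.
  rewrite mxE [X in _ = X + _]mxE [X in _ = _ + X]mxE !er_entry eqxx mulr1.
  by rewrite -val_eqE /= mulr0 add0r.
- rewrite eqxx mul1r mul0r !add0r mxE [X in _ = _ + X]mxE er_entry eqxx mulr1.
  by rewrite addrC subrK.
have [-> | niz] := eqVneq i iz; first by rewrite UT_diag // !mul0r !addr0.
have Ui := inU_er F lt; have [ui0 ui1] := inUP _ Ui.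
have rY : er i *m yr c r = er i.
  rewrite mulmxDr mulmx1 mulmxDr !mulmxA !row_ec ui0 ui1 !raddf0 !mul0mx.
  by rewrite !addr0.
have Epl : phi (yr c r) *m phi (lr (er i)) = phi (lr (er i)) *m phi (yr c r).
  by apply/(PC_commute PC); rewrite ?UT_lr //; apply/(commute_lr UY).
have h0 : (er i + rho (er i) *: er iz) 0 i0 = 0.
  by rewrite mxE [X in _ + X]mxE ui0 er_entry mulr0 addr0.
move: Epl; rewrite phi_lr // => /(commute_lr UpY h0).
rewrite mulmxDl -scalemxAl UT_erz // => /addIr.
move=> /(congr1 (fun w : 'rV_n => w 0 iz)); rewrite er_mul er_entry => ->.
have /negPf-> : i != i0 by rewrite -val_eqE /= gtn_eqF // ltnW.
have /negPf-> : i != i1 by rewrite -val_eqE /= gtn_eqF.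
by rewrite !mul0r !addr0 eq_sym (negPf niz).
Qed.

Lemma rho_qr c r c' r' : inU r -> inU r' ->
  rho (c *: r' - c' *: r) = c * qr c' r' - c' * qr c r.
Proof.
move=> Ur Ur'; have [d Ed] := phi_yr c Ur; have [d' Ed'] := phi_yr c' Ur'.
have UY : is_UT (yr c r) by apply: UT_wr.
have UY' : is_UT (yr c' r') by apply: UT_wr.
have Uz q : inU (q *: er iz).
  by apply/inUP; rewrite !mxE !mulr0.
have s0 e e' : (e *: er i1 + e' *: er iz) 0 i0 = 0.
  by rewrite mxE cs0 add0r mxE er_entry mulr0.
have s1 e e' : (e *: er i1 + e' *: er iz) 0 i1 = e.
  by rewrite mxE cs1 mxE er_entry mulr0 addr0.
have := PC_comm PC UY UY'.
rewrite {1}/yr comm_wr // !cs1 phi_lr ?inU_lin // Ed Ed' comm_wr ?inUD // !s1.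
move/lr_inj/(congr1 (fun w : 'rV_n => w 0 iz)); rewrite !mxE !eqxx /= !mulr1.
move/eqP; rewrite -subr_eq0 => /eqP E; apply/eqP; rewrite -subr_eq0 -E; apply/eqP; ring.
Qed.

Let qr10 : qr 1 0 = 0.
Proof.
rewrite /qr /yr /wr scale1r mulmx0 addr0 -/(lr (er i1)) phit1 lr_entry.
by rewrite mul0r mxE subr0 addr0 -val_eqE /= .
Qed.

(** Pair [yr 1 0] with [yr c r] in [rho_qr]: [yr 1 0] is [lr (er i1)], whose image still has a
    standard second row, so [qr 1 0 = 0]. *)
Let qrE c r : inU r -> qr c r = rho r.
Proof.
move=> Ur; have := rho_qr 1 c (inU0 F m) Ur.
by rewrite scale1r scaler0 subr0 mul1r qr10 mulr0 subr0.
Qed.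

Lemma rho_linear c r c' r' : inU r -> inU r' ->
  rho (c *: r' - c' *: r) = c * rho r' - c' * rho r.
Proof. by move=> Ur Ur'; rewrite rho_qr // !qrE. Qed.

Lemma rho_erz : rho (er iz) = 0.
Proof.
have V0 : inV (ec i0) by apply: inV_ec.
by rewrite /rho lr_erz phiV // -lr_erz lr_entry er_entry !eqxx mul1r add0r subrr.
Qed.

(** The column representing the linear form [rho]. Rows in [inU] do not see its first two entries,
    which are set to 0. *)
Let uc : 'cV[F]_n := \col_k if (i1 < k)%N then rho (er k) else 0.

Lemma inU_sum r : inU r -> r = \sum_(k < n | (i1 < k)%N) r 0 k *: er k.
Proof.
move=> Ur; apply/matrixP=> i j; rewrite [i]ord1 summxE.
have [lt|le] := ltnP i1 j.
  rewrite (bigD1 j) //= big1 ?addr0 => [|k /andP[_ ne]].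
    by rewrite mxE er_entry eqxx mulr1.
  by rewrite mxE er_entry eq_sym (negPf ne) mulr0.
rewrite inU_le // big1 // => k lt; rewrite mxE er_entry -val_eqE ltn_eqF ?mulr0 //.
exact: leq_ltn_trans le lt.
Qed.

Lemma rho_uc r : inU r -> rho r = (r *m uc) 0 0.
Proof.
move=> Ur; have -> : rho r = \sum_(k < n | (i1 < k)%N) r 0 k * rho (er k).
  rewrite {1}(inU_sum Ur).
  pose K (u : 'rV[F]_n) (e : F) := inU u /\ rho u = e.
  suff [] : K (\sum_(k < n | (i1 < k)%N) r 0 k *: er k)
              (\sum_(k < n | (i1 < k)%N) r 0 k * rho (er k)) by [].
  apply: (big_ind2 K).
  - split; first exact: inU0.
    by have := rho_linear 0 0 (inU0 F m) (inU0 F m); rewrite !scale0r subrr !mul0r subrr.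
  - move=> u w u' w' [Vu <-] [Vu' <-]; split; first exact: inUD.
    by have := rho_linear 1 (-1) Vu' Vu; rewrite !scale1r scaleN1r opprK mul1r mulN1r opprK.
  - move=> k lt; have Uk := inU_er F lt; split.
      by have := inU_lin (r 0 k) 0 Uk Uk; rewrite scale0r subr0.
    by have := rho_linear (r 0 k) 0 Uk Uk; rewrite scale0r mul0r !subr0.
rewrite mxE [RHS](bigID (fun k : 'I_n => (i1 < k)%N)) /=.
rewrite [X in _ = _ + X]big1 ?addr0 => [|k /negPf nlt]; last by rewrite mxE nlt mulr0.
by apply: eq_bigr => k lt; rewrite mxE lt.
Qed.

Lemma row_normal_form : exists u : 'cV[F]_n,
  [/\ u i1 0 = 0, u iz 0 = 0 &
     forall r, inU r -> phi (lr r) = lr (r + (r *m u) 0 0 *: er iz)].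
Proof.
exists uc; split; [by rewrite mxE | by rewrite mxE rho_erz |].
by move=> r Ur; rewrite phi_lr // rho_uc.
Qed.

End RowPart.

(** * Fixed columns and rows leave only the corner entry *)

Section CentralEnd.
Variables (F : fieldType) (m : nat).
Local Notation n := m.+4.
Local Notation i0 := (ix0 m).
Local Notation i1 := (ix1 m).
Local Notation iy := (ixy m).
Local Notation iz := (ixz m).

(** The row moves show that [invmx (phi a)] and [invmx a] agree outside the first row, so
    [(phi a)^-1 a = 1 + e_1 w] and [a = phi a + e_1 w]. With [phi_columns], only entry [(1, z)] may
    differ. *)
Lemma central_of_fixed (phi : 'M[F]_n -> 'M[F]_n) (r1 : 'rV[F]_n) : PC_map phi ->
  phi (tc (ec F iy)) = tc (ec F iy) ->
  (forall v, inV v -> phi (tc v) = tc v) ->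
  phi (lr (er F i1)) = lr r1 ->
  (forall r, inU r -> phi (lr r) = lr r) ->
  forall a, is_UT a -> exists c, phi a = a + c *: delta_mx i0 iz.
Proof.
move=> PC phit phiV phit1 phiU a Ua; have Up := PC_UT PC Ua.
have rows k : k != i0 -> er F k *m invmx (phi a) = er F k *m invmx a.
  move=> nk; suff /addIr : er F k *m invmx (phi a) - er F k = er F k *m invmx a - er F k by [].
  apply: (@lr_inj F m); have [lt|/leq_i1[ek|ek]] := ltnP i1 k.
  - have Uk := inU_er F lt; have [k0 k1] := inUP _ Uk.
    rewrite -comm_lr // -{1}(phiU _ Uk) -PC_comm ?UT_lr // comm_lr //.
    by rewrite phiU // inU_move.
  - by rewrite ek eqxx in nk.
  rewrite ek -(phi_lr_move PC phit phiV phit1) // phiU //.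
  apply/inUP; split; rewrite mxE [X in _ + X]mxE.
    by rewrite row_UT_entry0 ?UT_inv // subrr.
  by rewrite row_UT_entry1 ?UT_inv // ?er_entry // subrr.
pose w := er F i0 *m (invmx (phi a) *m a - 1%:M).
have EB : invmx (phi a) *m a = 1%:M + ec F i0 *m w.
  apply/matrixP=> i j; rewrite [RHS]mxE ec_mul_entry /w er_mul.
  have [-> | ni] := eqVneq i i0.
    by rewrite mul1r [X in _ = _ + X]mxE addrCA [X in _ + (_ + X)]mxE subrr addr0.
  by rewrite mul0r addr0 -er_mul mulmxA rows // -mulmxA mulVmx ?UT_unit // er_mul.
have Ea : a = phi a + ec F i0 *m w.
  have : phi a *m (invmx (phi a) *m a) = a by rewrite mulKVmx ?UT_unit.
  by rewrite EB mulmxDr mulmx1 mulmxA UT_ec0.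
exists (phi a i0 iz - a i0 iz); apply/matrixP=> i j; rewrite [RHS]mxE [X in _ = _ + X]mxE mxE.
have [ej | nj] := eqVneq j iz; last first.
  by rewrite andbF mulr0 addr0 (phi_columns PC phit phiV).
rewrite ej andbT; have [-> | ni] := eqVneq i i0; first by rewrite mulr1 addrC subrK.
by rewrite mulr0 addr0 [in RHS]Ea [RHS]mxE ec_mul_entry (negPf ni) mul0r addr0.
Qed.

End CentralEnd.

(** * Reduction to a central map *)

Section Reduction.
Variables (F : fieldType) (m : nat).
Local Notation n := m.+4.
Local Notation i0 := (ix0 m).
Local Notation i1 := (ix1 m).
Local Notation iy := (ixy m).
Local Notation iz := (ixz m).
Local Notation ec := (@ec F m).
Local Notation er := (@er F m).
Local Notation tc := (@tc F m).
Local Notation lr := (@lr F m).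
Implicit Types (a x P R : 'M[F]_n) (phi : 'M[F]_n -> 'M[F]_n).

Lemma munitE (i j : 'I_n) : munit F n i j = delta_mx i j.
Proof. by apply/matrixP=> k l; rewrite !mxE. Qed.

Lemma tr_corner (c : F) : tr n 0 n.-1 c = tc (c *: ec i0).
Proof. by rewrite /tr (munitE i0 iz) /tc -scalemxAl ec_er. Qed.

(** The tail of the decomposition. The next lemmas show that it may be proved after composing [phi]
    with a triangular conjugation or a field automorphism. *)
Definition qf_central phi := exists P (theta : {rmorphism F -> F}) (c : 'M[F]_n -> 'M[F]_n),
  [/\ is_T P, bijective theta, central_PC c &
      {in @is_UT F n, forall a, phi a = quasi_inner P (field_aut theta (c a))}].

Lemma qf_central_conj P phi : is_T P ->
  qf_central (fun a => quasi_inner P (phi a)) -> qf_central phi.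
Proof.
move=> TP [P' [theta [c [TP' bt Cc E]]]]; exists (invmx P *m P'), theta, c; split=> //.
  by rewrite T_mul ?T_inv.
move=> a Ua; have := E a Ua; have [uP uP'] := (is_T_unit TP, is_T_unit TP').
rewrite /quasi_inner invmx_mul ?unitmx_inv // invmxK => Ea.
by rewrite -[LHS](mulKmx uP) -[P *m phi a](mulmxKV uP) Ea !mulmxA.
Qed.

Lemma T_map (theta : {rmorphism F -> F}) P : is_T P -> is_T (map_mx theta P).
Proof.
move=> /is_TP[lP uP]; apply/is_TP; rewrite map_unitmx uP; split=> // i j lt.
by rewrite mxE lP // rmorph0.
Qed.

(** A field automorphism moves past a conjugation by [P] at the price of replacing [P] by
    [map_mx theta P]. *)
Lemma qf_central_field (theta theta' : {rmorphism F -> F}) phi :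
  cancel theta theta' -> cancel theta' theta ->
  qf_central (fun a => field_aut theta' (phi a)) -> qf_central phi.
Proof.
move=> K1 K2 [P [th [c [TP bt Cc E]]]].
exists (map_mx theta P), (theta \o th : {rmorphism F -> F}), c; split=> //.
- exact: T_map.
- by apply: bij_comp => //; exists theta'.
move=> a Ua; have := E a Ua; rewrite /field_aut => Ea.
have -> : phi a = map_mx theta (map_mx theta' (phi a)).
  by apply/matrixP=> i j; rewrite !mxE K2.
rewrite Ea /quasi_inner !map_mxM map_invmx; congr (_ *m _ *m _).
by apply/matrixP=> i j; rewrite !mxE.
Qed.

Lemma qf_central_central phi : PC_map phi ->
  (forall a, is_UT a -> exists c, phi a = a + c *: delta_mx i0 iz) -> qf_central phi.
Proof.
move=> PC H; pose f a := phi a i0 iz - a i0 iz.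
have E : {in @is_UT F n, phi =1 central_map f}.
  move=> a Ua; have [c Ec] := H a Ua.
  have fa : f a = c by rewrite /f Ec !mxE !eqxx mulr1 addrAC subrr add0r.
  rewrite /central_map tr_corner fa mulmxDr mulmx1 -scalemxAl -scalemxAr mulmxA.
  by rewrite UT_ec0 // ec_er.
exists 1%:M, (idfun : {rmorphism F -> F}), (central_map f); split.
- exact/UT_T/UT1.
- by exists idfun.
- by split; [apply: PC_ext E PC | exists f].
move=> a Ua; rewrite E // /field_aut map_mx_id /quasi_inner; last by [].
by rewrite mul1mx invmx1 mulmx1.
Qed.

Lemma conj_tc P (v : 'cV[F]_n) : P \in unitmx -> er iz *m P = er iz ->
  quasi_inner P (tc v) = tc (P *m v).
Proof.
move=> uP EP; rewrite /quasi_inner /tc mulmxDr mulmx1 mulmxDl mulmxV // mulmxA.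
by rewrite -(mulmxA _ (er iz)) -{1}EP mulmxK.
Qed.

Lemma T_ec0 P : is_T P -> P *m ec i0 = P i0 i0 *: ec i0.
Proof.
move=> /is_TP[lP _]; apply/matrixP=> i j; rewrite [j]ord1 mul_ec mxE ec_entry.
have [-> | ni] := eqVneq i i0; first by rewrite mulr1.
by rewrite mulr0 lP // lt0n; move: ni; rewrite -val_eqE.
Qed.

Lemma conj_lr P (r : 'rV[F]_n) : is_T P ->
  quasi_inner P (lr r) = lr (P i0 i0 *: (r *m invmx P)).
Proof.
move=> TP; rewrite /quasi_inner /lr mulmxDr mulmx1 mulmxDl mulmxV ?is_T_unit //.
by rewrite mulmxA T_ec0 // -!scalemxAl -scalemxAr mulmxA.
Qed.

Lemma map_tc (theta : {rmorphism F -> F}) (v : 'cV[F]_n) :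
  field_aut theta (tc v) = tc (map_mx theta v).
Proof. by rewrite /field_aut map_mxD map_mx1 map_mxM map_delta_mx. Qed.

Lemma map_lr (theta : {rmorphism F -> F}) (r : 'rV[F]_n) :
  field_aut theta (lr r) = lr (map_mx theta r).
Proof. by rewrite /field_aut map_mxD map_mx1 map_mxM map_delta_mx. Qed.

(** On rows, [r + (r u) e'_z] is [r] times [tc u], so conjugation by [tc u] restores [r]. It keeps
    the columns fixed, as [tc u] fixes every [v] with [v_z = 0]. *)
Lemma qf_central_of_columns phi (r1 : 'rV[F]_n) : PC_map phi ->
  phi (tc (ec iy)) = tc (ec iy) -> (forall v, inV v -> phi (tc v) = tc v) ->
  phi (lr (er i1)) = lr r1 -> qf_central phi.
Proof.
move=> PC phit phiV phit1.
have [u [u1 uz phiU]] := row_normal_form PC phit phiV phit1.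
have Ug : is_UT (tc u) by apply: UT_tc.
have Tg := UT_T Ug; have ug := UT_unit Ug; have eg := UT_erz Ug.
have Eg (v : 'cV[F]_n) : v iz 0 = 0 -> tc u *m v = v.
  by move=> vz; rewrite mulmxDl mul1mx -mulmxA er_col vz raddf0 ?mulmx0 addr0.
apply: (qf_central_conj Tg); apply: qf_central_central.
  by apply: PC_comp PC (PC_conj Tg).
apply: (@central_of_fixed F m _ (tc u i0 i0 *: (r1 *m invmx (tc u)))).
- by apply: PC_comp PC (PC_conj Tg).
- by rewrite phit conj_tc // Eg // ec_entry -val_eqE /= gtn_eqF.
- by move=> v Vv; rewrite phiV // conj_tc // Eg //; case/inVP: Vv.
- by rewrite phit1 conj_lr.
move=> r Ur; rewrite phiU // conj_lr // UT_diag // scale1r; congr lr.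
apply: (can_inj (mulmxK ug)); rewrite mulmxKV // mulmxDr mulmx1 mulmxA.
by congr (_ + _); rewrite [r *m u]mx11_scalar mul_scalar_mx [in LHS]mxE /= mulr1n.
Qed.

Lemma qf_central_of_tc phi (v : 'cV[F]_n) (r : 'rV[F]_n) : PC_map phi ->
  phi (tc (ec iy)) = tc v -> v iz 0 = 0 -> v iy 0 != 0 ->
  phi (lr (er i1)) = lr r -> qf_central phi.
Proof.
move=> PC phit vz vy phit1.
(* The identity with column [y] replaced by [v]: triangular because [v_z = 0], invertible because
   [v_y] is nonzero. Conjugation by its inverse turns [tc v] into [tc (ec iy)]. *)
pose R := 1%:M + (v - ec iy) *m er iy.
have RE i j : R i j = if j == iy then v i 0 else (i == j)%:R.
  have E : (v - ec iy) i 0 = v i 0 - (i == iy)%:R by rewrite mxE [X in _ + X]mxE ec_entry.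
  rewrite mxE [X in X + _]mxE mul_er_entry E; case: (j =P iy) => [->|_].
    by rewrite mulr1 addrC subrK.
  by rewrite mulr0 addr0.
have lR (i j : 'I_n) : (j < i)%N -> R i j = 0.
  move=> lt; rewrite RE; case: (j =P iy) => [ej|_]; last by rewrite -val_eqE gtn_eqF.
  suff -> : i = iz by [].
  have le : (iy <= i)%N by rewrite -ej; apply: ltnW.
  by case: (geq_iy le) => // ei; rewrite ei ej ltnn in lt.
have TR : is_T R.
  apply/is_TP; split=> //; rewrite unitmxE upper_det // unitfE prodf_seq_neq0.
  apply/allP=> i _; apply/implyP=> _; rewrite RE; case: (i =P iy) => [->//|_].
  by rewrite eqxx oner_eq0.
have uR := is_T_unit TR.
have Ry : R *m ec iy = v.
  by rewrite mulmxDl mul1mx -mulmxA er_col ec_entry eqxx mulmx1 addrC subrK.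
have Rz : er iz *m R = er iz.
  apply/matrixP=> i j; rewrite [i]ord1 er_mul er_entry RE.
  by case: (j =P iy) => [->|_]; [rewrite vz -val_eqE /= ltn_eqF | rewrite eq_sym].
have TP := T_inv TR; have uP := is_T_unit TP.
have Pz : er iz *m invmx R = er iz by rewrite -{1}Rz mulmxK.
apply: (qf_central_conj TP).
set phi3 := fun a => _; have PC3 : PC_map phi3 := PC_comp PC (PC_conj TP).
have phit3 : phi3 (tc (ec iy)) = tc (ec iy).
  by rewrite /phi3 phit conj_tc // -Ry mulKmx.
have [M [theta [theta' [TM [K1 K2] My Mz phiV]]]] := column_normal_form PC3 phit3.
have TI := T_inv TM; have [uM uI] := (is_T_unit TM, is_T_unit TI).
have Iz : er iz *m invmx M = er iz by rewrite -{1}Mz mulmxK.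
apply: (qf_central_conj TI); apply: (qf_central_field K1 K2).
(* Conjugation by [invmx M] and then [theta'] undo the map [v] to [M theta(v)]. *)
have PC5 := PC_comp (PC_comp PC3 (PC_conj TI)) (PC_field n K2 K1).
apply: (qf_central_of_columns PC5) => [|w Vw|].
- by rewrite phit3 conj_tc // map_tc -{1}My mulKmx // map_delta_mx.
- rewrite phiV // conj_tc // mulKmx // map_tc; congr tc.
  by apply/matrixP=> i j; rewrite !mxE K1.
- by rewrite /phi3 phit1 conj_lr // conj_lr // map_lr.
Qed.

Lemma entE x (i j : 'I_n) : ent x i j = x i j.
Proof. by rewrite /ent !valK. Qed.

(** The two factors act additively: [e_2z x = e_2z], [x e_1y = e_1y], and [e_2z e_1y = 0]. *)
Lemma subcentralE (al be : F) x : is_UT x ->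
  std_subcentral al be x =
  x + ((al * x i0 i1) *: (ec i1 *m er iz) + (be * x iy iz) *: (ec i0 *m er iy)).
Proof.
move=> Ux; rewrite /std_subcentral (entE x i0 i1) (entE x iy iz).
have -> : tr n 1 n.-1 (al * x i0 i1) = 1%:M + (al * x i0 i1) *: (ec i1 *m er iz).
  by rewrite /tr (munitE i1 iz) ec_er.
have -> : tr n 0 (n - 2) (be * x iy iz) = 1%:M + (be * x iy iz) *: (ec i0 *m er iy).
  by rewrite /tr (munitE i0 iy) ec_er.
rewrite [(1%:M + _) *m x]mulmxDl mul1mx -scalemxAl -mulmxA UT_erz // mulmxDr mulmx1.
rewrite -scalemxAr mulmxDl mulmxA UT_ec0 // -scalemxAl mulmxA -(mulmxA _ (er iz)).
by rewrite er_col ec_entry raddf0 ?mulmx0 mul0mx scaler0 addr0 addrA.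
Qed.

End Reduction.

(** * Subcentral maps and images of the generators *)

Section Subcentral.
Variables (F : fieldType) (m : nat).
Local Notation n := m.+4.
Local Notation i0 := (ix0 m).
Local Notation i1 := (ix1 m).
Local Notation iy := (ixy m).
Local Notation iz := (ixz m).
Local Notation ec := (@ec F m).
Local Notation er := (@er F m).
Local Notation tc := (@tc F m).
Local Notation lr := (@lr F m).
Implicit Types (a x y P R : 'M[F]_n) (phi : 'M[F]_n -> 'M[F]_n).

Lemma UT_ec1 x : is_UT x -> x *m ec i1 = ec i1 + x i0 i1 *: ec i0.
Proof.
move=> Ux; apply/matrixP=> i j; rewrite [j]ord1 mul_ec mxE ec_entry mxE ec_entry.
have [lt|/leq_i1[]->] := ltnP i1 i; last 2 first.
- by rewrite eqxx mulr1 add0r.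
- by rewrite UT_diag // eqxx mulr0 addr0.
rewrite (UT_low Ux lt) -!val_eqE /= !gtn_eqF //; last by rewrite ltnW.
by rewrite mulr0 addr0.
Qed.

Lemma UT_ery x : is_UT x -> er iy *m x = er iy + x iy iz *: er iz.
Proof.
move=> Ux; apply/matrixP=> i j; rewrite [i]ord1 er_mul mxE er_entry mxE er_entry.
have [lt|/geq_iy[]->] := ltnP j iy.
- rewrite (UT_low Ux lt) -!val_eqE /= !ltn_eqF ?mulr0 ?addr0 //.
  by rewrite ltnS ltnW.
- by rewrite UT_diag // eqxx -val_eqE /= ltn_eqF // mulr0 addr0.
- by rewrite eqxx mulr1 -val_eqE /= gtn_eqF // add0r.
Qed.

Lemma UT_super x y : is_UT x -> is_UT y ->
  (x *m y) i0 i1 = x i0 i1 + y i0 i1 /\ (x *m y) iy iz = x iy iz + y iy iz.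
Proof.
move=> Ux Uy; split.
  have := congr1 (fun v : 'cV_n => v i0 0) (UT_ec1 (UT_mul Ux Uy)).
  rewrite -mulmxA UT_ec1 // mulmxDr UT_ec1 // -scalemxAr UT_ec0 //.
  by rewrite !mxE !eqxx !mulr1 !add0r.
have := congr1 (fun v : 'rV_n => v 0 iz) (UT_ery (UT_mul Ux Uy)).
rewrite mulmxA UT_ery // mulmxDl UT_ery // -scalemxAl UT_erz //.
rewrite !mxE !eqxx !mulr1 -val_eqE /= gtn_eqF // !add0r => <-.
by rewrite addrC.
Qed.

(** Both entries are additive characters by [UT_super], hence trivial on commutators; consequently
    subcentral maps fix commutators. *)
Lemma comm_super x y : is_UT x -> is_UT y ->
  comm x y i0 i1 = 0 /\ comm x y iy iz = 0.
Proof.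
move=> Ux Uy; have Uc := UT_comm Ux Uy; have Uyx := UT_mul Uy Ux.
have [] := UT_super Uc Uyx; rewrite comm_mulK //.
have [-> ->] := UT_super Ux Uy; have [-> ->] := UT_super Uy Ux.
move=> E1 E2; split.
  by apply: (addIr (y i0 i1 + x i0 i1)); rewrite -E1 add0r addrC.
by apply: (addIr (y iy iz + x iy iz)); rewrite -E2 add0r addrC.
Qed.

(** * Standard subcentral maps preserve commutators *)

Section Maps.
Variables al be : F.
Local Notation D c d := (c *: (ec i1 *m er iz) + d *: (ec i0 *m er iy)).
Local Notation S := (@std_subcentral F n).

Let D_entry c d i j : (D c d : 'M[F]_n) i j =
  c * ((i == i1)%:R * (j == iz)%:R) + d * ((i == i0)%:R * (j == iy)%:R).
Proof. by rewrite mxE [X in X + _]mxE [X in _ + X]mxE !mul_er_entry !ec_entry. Qed.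

Lemma UT_subcentral x : is_UT x -> is_UT (S al be x).
Proof.
move=> Ux; rewrite subcentralE //; apply/is_UTP=> i j le; rewrite mxE D_entry.
have z1 : (i == i1)%:R * (j == iz)%:R = 0 :> F.
  case: (i =P i1) => [ei|_]; last by rewrite mul0r.
  by case: (j =P iz) => [ej|_]; rewrite ?mulr0 //; move: le; rewrite ei ej.
have z0 : (i == i0)%:R * (j == iy)%:R = 0 :> F.
  case: (i =P i0) => [ei|_]; last by rewrite mul0r.
  by case: (j =P iy) => [ej|_]; rewrite ?mulr0 //; move: le; rewrite ei ej.
by rewrite z1 z0 !mulr0 !addr0 (is_UTP _ Ux).
Qed.

Lemma subcentral_super x : is_UT x ->
  S al be x i0 i1 = x i0 i1 /\ S al be x iy iz = x iy iz.
Proof.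
move=> Ux; rewrite subcentralE //; split; rewrite mxE D_entry -!val_eqE /=.
  by rewrite !mul0r !mulr0 !addr0.
by rewrite !mul0r !mulr0 !addr0.
Qed.

Let mul_D x c d : is_UT x -> x *m D c d = D c d + (c * x i0 i1) *: (ec i0 *m er iz).
Proof.
move=> Ux; rewrite mulmxDr -!scalemxAr !mulmxA UT_ec0 // UT_ec1 // mulmxDl -scalemxAl.
by rewrite scalerDr scalerA addrAC.
Qed.

Let D_mul x c d : is_UT x -> D c d *m x = D c d + (d * x iy iz) *: (ec i0 *m er iz).
Proof.
move=> Ux; rewrite mulmxDl -!scalemxAl -!mulmxA UT_erz // UT_ery // mulmxDr -scalemxAr.
by rewrite scalerDr scalerA addrA.
Qed.

Let D_D c d c' d' : D c d *m D c' d' = 0.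
Proof.
(* The indices [y] and 2 differ because the size is at least 4. *)
have ne : (iy == i1) = false by rewrite -val_eqE.
rewrite mulmxDl !mulmxDr -!scalemxAl -!scalemxAr !mulmxA -!(mulmxA _ (er _) (ec _)).
by rewrite !er_col !ec_entry ne !raddf0 ?mulmx0 ?mul0mx ?scaler0 !addr0.
Qed.

Let subcentral_mul x y : is_UT x -> is_UT y ->
  S al be x *m S al be y = x *m y + (D (al * (x i0 i1 + y i0 i1)) (be * (x iy iz + y iy iz))
    + (al * x i0 i1 * y i0 i1 + be * x iy iz * y iy iz) *: (ec i0 *m er iz)).
Proof.
move=> Ux Uy; rewrite !subcentralE // mulmxDl !(mulmxDr _ y) D_D addr0 mul_D // D_mul //.
rewrite -addrA; congr (_ + _).
move: (ec i1 *m er iz) (ec i0 *m er iy) (ec i0 *m er iz) => A B C.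
by apply/matrixP=> i j; rewrite !mxE; ring.
Qed.

(** The correction added to [x y] in [subcentral_mul] is symmetric in [x] and [y], and left
    multiplication by a commutator fixes it. *)
Lemma subcentral_comm x y : is_UT x -> is_UT y ->
  S al be (comm x y) = comm (S al be x) (S al be y).
Proof.
move=> Ux Uy; have Uc := UT_comm Ux Uy; have [c1 c2] := comm_super Ux Uy.
rewrite subcentralE // c1 c2 !mulr0 !scale0r !addr0; apply/esym.
apply: comm_eq; rewrite ?UT_subcentral // !subcentral_mul // mulmxDr comm_mulK //.
congr (_ + _); rewrite mulmxDr mul_D // c1 mulr0 scale0r addr0 -scalemxAr mulmxA UT_ec0 //.
congr (_ + _); first by rewrite [y i0 i1 + _]addrC [y iy iz + _]addrC.
by congr (_ *: _); ring.
Qed.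

End Maps.

Lemma subcentralK (al be : F) x : is_UT x ->
  std_subcentral (- al) (- be) (std_subcentral al be x) = x.
Proof.
move=> Ux; have [E1 E2] := subcentral_super al be Ux.
rewrite subcentralE ?UT_subcentral // E1 E2 subcentralE // -addrA !mulNr !scaleNr.
by rewrite -opprD subrr addr0.
Qed.

Lemma PC_subcentral (al be : F) : PC_map (@std_subcentral F n al be).
Proof.
split.
- by move=> x; apply: UT_subcentral.
- by move=> x y Ux Uy E; rewrite -[x](subcentralK al be) // E subcentralK.
- move=> y Uy; exists (std_subcentral (- al) (- be) y); first exact: UT_subcentral.
  by rewrite -{1}[al]opprK -{1}[be]opprK subcentralK.
- by move=> x y; apply: subcentral_comm.
Qed.

Lemma iy_lt i : i != iz -> i != iy -> (i < iy)%N.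
Proof.
by move=> nz ny; rewrite ltnNge; apply/negP=> /geq_iy[]E; rewrite E eqxx in nz ny.
Qed.

(** * Almost rank one matrices with a nonzero extreme superdiagonal entry *)

Section Shapes.
Hypothesis hchar : (2%:R : F) != 0.
Variable x : 'M[F]_n.
Hypotheses (Ux : is_UT x) (Hx : commutes_with_comms x).
Let N := x - 1%:M.

Let NE i j : N i j = x i j - (i == j)%:R.
Proof. by rewrite mxE [X in _ + X]mxE mxE. Qed.

(** With [N_yz] nonzero, [N_ip N_yz = 0] clears the columns [p < y]. Then [(N^2)_iz] reduces to
    [N_iy N_yz], and its vanishing clears column [y] outside the first row. *)
Lemma shape_last_column : x iy iz != 0 -> exists (b : F) (v : 'cV[F]_n),
  [/\ v iz 0 = 0, v iy 0 = x iy iz & x = wc (b *: ec i0) v].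
Proof.
move=> xyz; have nyz : (iy == iz) = false by rewrite -val_eqE /= ltn_eqF.
have Nyz : N iy iz != 0 by rewrite NE nyz subr0.
have cols (i k : 'I_n) : (k < iy)%N -> N i k = 0.
  move=> lt; have [-> | ne] := eqVneq i k; first by rewrite NE eqxx UT_diag // subrr.
  have nzy : iz != iy by rewrite eq_sym nyz.
  apply/eqP; have := square_zero_entries hchar Ux Hx lt ne nzy.
  by move/eqP; rewrite mulf_eq0 (negPf Nyz) orbF.
have coly i : i != i0 -> N i iy = 0.
  move=> ni; have [-> | niz] := eqVneq i iz.
    by rewrite NE (UT_low Ux) // eq_sym nyz subrr.
  have lt0i : (i0 < i)%N by rewrite lt0n; move: ni; rewrite -val_eqE.
  have := @square_zero_row _ _ hchar _ Ux Hx i0 i iz lt0i; rewrite eq_sym => /(_ niz).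
  rewrite -/N mxE (bigD1 iy) //= big1 ?addr0 => [/eqP|k nk].
    by rewrite mulf_eq0 (negPf Nyz) orbF => /eqP.
  have [-> | nkz] := eqVneq k iz; first by rewrite (NE iz iz) eqxx UT_diag // subrr mulr0.
  by rewrite cols ?mul0r // iy_lt.
exists (x i0 iy), (x *m ec iz - ec iz); split.
- by rewrite move_entry UT_diag // eqxx subrr.
- by rewrite move_entry nyz subr0.
have -> : x i0 iy *: ec i0 = x *m ec iy - ec iy.
  apply/matrixP=> i j; rewrite [j]ord1 move_entry mxE ec_entry -NE.
  have [-> | ni] := eqVneq i i0; last by rewrite coly // mulr0.
  by rewrite NE mulr1 -val_eqE /= subr0.
apply: wc_form => // k lt; apply/matrixP=> i j; rewrite [j]ord1 mul_ec ec_entry.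
by apply/eqP; rewrite -subr_eq0 -NE cols.
Qed.

(** The mirror argument: [N_12] clears the rows beyond the second, then [(N^2)_1j = N_12 N_2j]
    clears row 2 outside column [z]. *)
Lemma shape_first_row : x i0 i1 != 0 -> exists (b : F) (r : 'rV[F]_n),
  [/\ r 0 i0 = 0, r 0 i1 = x i0 i1 & x = wr r (b *: er iz)].
Proof.
move=> x01; have N01 : N i0 i1 != 0 by rewrite NE -val_eqE /= subr0.
have rows (k j : 'I_n) : (i1 < k)%N -> N k j = 0.
  move=> lt; have [-> | ne] := eqVneq j k; first by rewrite NE eqxx UT_diag // subrr.
  apply/eqP; have := square_zero_entries hchar Ux Hx lt (isT : i0 != i1) ne.
  by move/eqP; rewrite mulf_eq0 (negPf N01).
have row1 j : j != iz -> N i1 j = 0.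
  move=> nj; have [-> | nj0] := eqVneq j i0.
    by rewrite NE (UT_low Ux) // -val_eqE /= subrr.
  have ltjz : (j < iz)%N.
    by have := ltn_ord j; move: nj; rewrite -val_eqE /=; lia.
  have := @square_zero_col _ _ hchar _ Ux Hx i0 j iz ltjz; rewrite eq_sym => /(_ nj0).
  rewrite -/N mxE (bigD1 i1) //= big1 ?addr0 => [/eqP|k nk].
    by rewrite mulf_eq0 (negPf N01) => /eqP.
  have [lt|/leq_i1[]ek] := ltnP i1 k; first by rewrite (rows k j lt) mulr0.
    by rewrite ek (NE i0 i0) eqxx UT_diag // subrr mul0r.
  by rewrite ek eqxx in nk.
exists (x i1 iz), (er i0 *m N); split.
- by rewrite er_mul NE UT_diag // eqxx subrr.
- by rewrite er_mul NE -val_eqE /= subr0.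
apply/matrixP=> i j; rewrite wr_entry er_mul.
have -> : (x i1 iz *: er iz) 0 j = x i1 iz * (j == iz)%:R by rewrite mxE er_entry.
have -> : x i j = (i == j)%:R + N i j by rewrite NE addrC subrK.
congr (_ + _); have [lt|/leq_i1[]->] := ltnP i1 i.
- have /negPf-> : i != i0 by rewrite -val_eqE /= gtn_eqF // ltnW.
  have /negPf-> : i != i1 by rewrite -val_eqE /= gtn_eqF.
  by rewrite rows // !mul0r addr0.
- by rewrite eqxx mul1r mul0r addr0.
rewrite mul1r mul0r add0r; have [-> | nj] := eqVneq j iz; last by rewrite row1 // mulr0.
by rewrite NE -val_eqE /= subr0 mulr1.
Qed.

End Shapes.

End Subcentral.

(** * The second center *)

Section SecondCenter.
Variables (F : fieldType) (m : nat).
Local Notation n := m.+4.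
Local Notation i0 := (ix0 m).
Local Notation i1 := (ix1 m).
Local Notation iy := (ixy m).
Local Notation iz := (ixz m).
Local Notation ec := (@ec F m).
Local Notation er := (@er F m).
Local Notation tc := (@tc F m).
Local Notation lr := (@lr F m).
Implicit Types (a x y w z : 'M[F]_n) (phi : 'M[F]_n -> 'M[F]_n).

Definition in_Z2 z := forall w, is_UT w -> exists c : F, comm z w = tc (c *: ec i0).

(** Testing against [1 + e_kl] gives [z e_kl = e_kl z + c e_1z]. The entry is isolated by [e_jy]
    when [j < y], by [e_yz] when [j = y], and by [e_2i] when [j = z], each time at a position other
    than [(1, z)]. *)
Lemma in_Z2_entry z (i j : 'I_n) : is_UT z -> in_Z2 z -> i != j ->
  ~~ [|| (i == i0) && (j == iy), (i == i1) && (j == iz) | (i == i0) && (j == iz)] ->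
  z i j = 0.
Proof.
move=> Uz Hz nij nc.
have E (k l : 'I_n) : (k < l)%N -> exists c : F, forall p q,
    z p k * (q == l)%:R = (p == k)%:R * z l q + c * ((p == i0)%:R * (q == iz)%:R).
  move=> lt; have Uw := UT_delta (1 : F) lt; have [c Ec] := Hz _ Uw.
  exists c => p q; have := comm_mulK Uz Uw.
  rewrite Ec tc_UT ?UT_mul // scale1r mulmxDr mulmxDl mul1mx mulmx1 -addrA => /addrI.
  move=> /matrixP/(_ p q); rewrite mxE delta_mul_entry mul_delta_entry -scalemxAl => <-.
  by rewrite [X in _ + X = _]mxE mul_er_entry ec_entry.
have [ltz | /geq_iy[ej|ej]] := ltnP j iy.
- have ltjy : (j < iy)%N by [].
  have [c /(_ i iy)] := E j iy ltjy.
  by rewrite eqxx (negPf nij) -[iy == iz]val_eqE /= ltn_eqF // !mulr0 mulr1 mul0r addr0.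
- have [c /(_ i iz)] := E iy iz (ltnSn _); rewrite -ej eqxx (negPf nij) mul0r add0r !mulr1.
  have ni : i != i0 by move: nc; rewrite ej eqxx andbT; case: eqP.
  by rewrite (negPf ni) mulr0.
have ni0 : i != i0 by move: nc; rewrite ej eqxx !andbT; case: (i == i0); rewrite ?orbT.
have ni1 : i != i1 by move: nc; rewrite ej eqxx !andbT; case: (i == i1); rewrite ?orbT.
have lt : (i1 < i)%N.
  by rewrite ltnNge; apply/negP=> /leq_i1[]e; rewrite e eqxx in ni0 ni1.
have [c /(_ i1 j)] := E i1 i lt.
rewrite eqxx eq_sym (negPf nij) mulr0 mul1r => /esym.
by rewrite [i1 == i0]val_eqE /= mul0r mulr0 addr0.
Qed.

Lemma in_Z2_commute z x : is_UT z -> in_Z2 z -> is_UT x ->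
  x i0 i1 = 0 -> x iy iz = 0 -> x *m z = z *m x.
Proof.
move=> Uz Hz Ux x01 xyz.
have -> : z = 1%:M + (z i0 iy *: (ec i0 *m er iy) + z i1 iz *: (ec i1 *m er iz)
              + z i0 iz *: (ec i0 *m er iz)).
  apply/matrixP=> i j; rewrite [RHS]mxE [X in _ = X + _]mxE [X in _ = _ + X]mxE.
  rewrite [X in _ = _ + (X + _)]mxE [X in _ = _ + (X + _ + _)]mxE.
  rewrite [X in _ = _ + (_ + X + _)]mxE [X in _ = _ + (_ + X)]mxE.
  rewrite !mul_er_entry !ec_entry -!natrM !mulnb.
  have nyz : (iy == iz) = false by rewrite -val_eqE /= ltn_eqF.
  have nzy : (iz == iy) = false by rewrite eq_sym.
  have n10 : (i1 == i0) = false by [].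
  have n01 : (i0 == i1) = false by [].
  have [|nc] := boolP [|| (i == i0) && (j == iy), (i == i1) && (j == iz)
                        | (i == i0) && (j == iz)].
    case/or3P=> /andP[/eqP-> /eqP->]; rewrite !eqxx ?nyz ?nzy ?n01 ?n10 /= ?mulr1 ?mulr0.
    + by rewrite !addr0 add0r.
    + by rewrite !addr0 !add0r.
    + by rewrite !add0r.
  have nc' := nc; move: nc'; rewrite !negb_or => /and3P[/negPf-> /negPf-> /negPf->].
  rewrite !mulr0 !addr0; have [-> | nij] := eqVneq i j; first by rewrite UT_diag.
  exact: in_Z2_entry.
rewrite mulmxDr mulmxDl mulmx1 mul1mx; congr (_ + _).
rewrite !mulmxDr !mulmxDl -!scalemxAr -!scalemxAl !mulmxA UT_ec0 // UT_ec1 // x01.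
by rewrite -!mulmxA UT_erz // UT_ery // xyz !scale0r !addr0.
Qed.

Lemma in_Z2_lr : in_Z2 (lr (er iy)).
Proof.
have U : is_UT (lr (er iy)) by apply: UT_lr; rewrite er_entry.
move=> w Uw; exists (w iy iz); apply: comm_eq => //.
rewrite tc_UT ?UT_mul // UT_mul_lr // mulmxDl mul1mx -mulmxA UT_ery //.
by rewrite mulmxDr -scalemxAr -scalemxAl addrA.
Qed.

Lemma in_Z2_tc : in_Z2 (tc (ec i1)).
Proof.
have U : is_UT (tc (ec i1)) by apply: UT_tc; rewrite ec_entry.
move=> w Uw; exists (- w i0 i1); apply: comm_eq => //.
rewrite (tc_UT _ Uw) tc_UT ?UT_mul // mulmxDr mulmx1 mulmxA UT_ec1 // mulmxDl.
by rewrite -!scalemxAl scaleNr addrA addrK.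
Qed.

Lemma PC_in_Z2 phi z : PC_map phi -> is_UT z -> in_Z2 z -> in_Z2 (phi z).
Proof.
move=> PC Uz Hz _ /(PC_surj PC)[u Uu <-]; have [c Ec] := Hz u Uu.
have Uc := UT_comm Uz Uu.
exists (phi (comm z u) i0 iz); rewrite -PC_comm //; apply: center_form; first exact: PC_UT.
move=> _ /(PC_surj PC)[a Ua <-]; apply/(PC_commute PC) => //.
by rewrite Ec tc_central.
Qed.

(** If both entries vanished, [phi x] would centralize the second centre, which contains [phi z]. *)
Lemma PC_super_neq0 phi x z : PC_map phi -> is_UT x -> is_UT z -> in_Z2 z ->
  x *m z <> z *m x -> phi x i0 i1 != 0 \/ phi x iy iz != 0.
Proof.
move=> PC Ux Uz Hz ne; have [E1|] := eqVneq (phi x i0 i1) 0; last by left.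
have [E2|] := eqVneq (phi x iy iz) 0; last by right.
case: ne; apply/(PC_commute PC) => //.
by apply: in_Z2_commute; rewrite ?PC_UT //; apply: PC_in_Z2.
Qed.

Let eryz_neq0 : er iz <> 0.
Proof.
by move=> /(congr1 (fun w : 'rV_n => w 0 iz)) /eqP; rewrite er_entry mxE eqxx oner_eq0.
Qed.

Let Ut : is_UT (tc (ec iy)).
Proof. by apply: UT_tc; rewrite ec_entry -val_eqE /= gtn_eqF. Qed.

Let Ut1 : is_UT (lr (er i1)).
Proof. by apply: UT_lr; rewrite er_entry. Qed.

Let lr_tc_noncommute k (v : 'cV[F]_n) : is_UT (tc v) -> k != i0 -> v k 0 = 1 ->
  tc v *m lr (er k) <> lr (er k) *m tc v.
Proof.
move=> U nk vk; have h0 : er k 0 i0 = 0 by rewrite er_entry eq_sym (negPf nk).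
move/(commute_lr U h0); rewrite mulmxDr mulmx1 mulmxA er_col vk mul1mx.
by rewrite -[RHS]addr0 => /addrI.
Qed.

Lemma conj_wc0 w (b : F) (v : 'cV[F]_n) : is_UT w -> v iz 0 = 0 ->
  exists v' : 'cV[F]_n, [/\ v' iz 0 = 0, v' iy 0 = v iy 0 &
    w *m wc (b *: ec i0) v *m invmx w = wc (b *: ec i0) v'].
Proof.
move=> Uw vz; have UI := UT_inv Uw.
exists (w *m v + (b * invmx w iy iz) *: ec i0); split.
- by rewrite mxE UT_mul_entry_z // vz [X in _ + X]mxE ec_entry mulr0 addr0.
- by rewrite mxE UT_mul_entry_y // [X in _ + X]mxE ec_entry mulr0 addr0.
rewrite /wc mulmxDr mulmx1 mulmxDl mulmxV ?UT_unit //; congr (_ + _).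
have E1 : w *m (b *: ec i0 *m er iy) *m invmx w = b *: (ec i0 *m (er iy *m invmx w)).
  by rewrite -scalemxAl -scalemxAr -scalemxAl !mulmxA UT_ec0.
have E2 : w *m (v *m er iz) *m invmx w = w *m v *m er iz.
  by rewrite !mulmxA -(mulmxA _ (er iz)) UT_erz.
rewrite mulmxDr mulmxDl E1 E2 UT_ery // mulmxDr -scalemxAr scalerDr scalerA mulmxDl.
by rewrite -!scalemxAl -addrA; congr (_ + _); rewrite addrC.
Qed.

(** * Images of the two extreme elementary matrices *)

Section Generators.
Hypothesis hchar : (2%:R : F) != 0.
Variable phi : 'M[F]_n -> 'M[F]_n.
Hypothesis PC : PC_map phi.

Let t_E : tc (ec iy) = 1%:M + delta_mx iy iz. Proof. by rewrite /tc ec_er. Qed.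
Let t1_E : lr (er i1) = 1%:M + delta_mx i0 i1. Proof. by rewrite /lr ec_er. Qed.

Let Ht : commutes_with_comms (phi (tc (ec iy))).
Proof.
by apply: PC_commutes_with_comms => //; rewrite t_E; apply: elementary_commutes_with_comms.
Qed.

Let Ht1 : commutes_with_comms (phi (lr (er i1))).
Proof.
by apply: PC_commutes_with_comms => //; rewrite t1_E; apply: elementary_commutes_with_comms.
Qed.

Lemma super_t : phi (tc (ec iy)) i0 i1 != 0 \/ phi (tc (ec iy)) iy iz != 0.
Proof.
apply: (@PC_super_neq0 _ _ (lr (er iy))) => //.
- by apply: UT_lr; rewrite er_entry.
- exact: in_Z2_lr.
- by apply: lr_tc_noncommute => //; rewrite ec_entry eqxx.
Qed.

(** Otherwise both images have the shape [wc (b e_1) v]. Conjugating the second keeps [b] and [v_y],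
    all that [comm_wc] sees, so the first commutes with all conjugates of the second and with its
    commutators. Pulled back, [tc (ec iy)] would commute with [lr (er iy)], the commutator of
    [lr (er i1)] with [1 + e_2y]; it does not. *)
Lemma super_t1 : phi (tc (ec iy)) iy iz != 0 -> phi (lr (er i1)) i0 i1 != 0.
Proof.
move=> tyz.
have [//|syz] : phi (lr (er i1)) i0 i1 != 0 \/ phi (lr (er i1)) iy iz != 0.
  have U1 : is_UT (tc (ec i1)) by apply: UT_tc; rewrite ec_entry.
  apply: (@PC_super_neq0 _ _ (tc (ec i1))) => //; first exact: in_Z2_tc.
  by apply/nesym/lr_tc_noncommute => //; rewrite ec_entry eqxx.
have UT := PC_UT PC Ut; have UT1 := PC_UT PC Ut1.
have [b [v [vz vy Et]]] := shape_last_column hchar UT Ht tyz.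
have [b' [v' [vz' vy' Es]]] := shape_last_column hchar UT1 Ht1 syz.
have Vb (c : F) : inV (c *: ec i0) by apply: inVZ; apply: inV_ec.
have Cts : tc (ec iy) *m lr (er i1) = lr (er i1) *m tc (ec iy).
  apply/(commute_lr Ut); first by rewrite er_entry.
  by rewrite mulmxDr mulmx1 mulmxA er_col ec_entry -val_eqE /= raddf0 mul0mx addr0.
have Cts' : phi (tc (ec iy)) *m phi (lr (er i1)) = phi (lr (er i1)) *m phi (tc (ec iy)).
  exact/(PC_commute PC).
have Call w : is_UT w -> phi (tc (ec iy)) *m comm (phi (lr (er i1))) w
                      = comm (phi (lr (er i1))) w *m phi (tc (ec iy)).
  move=> Uw; apply: commute_comm => //.
  have Uc : is_UT (w *m phi (lr (er i1)) *m invmx w) by rewrite !UT_mul ?UT_inv.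
  apply/(comm_eq1 UT Uc); move/(comm_eq1 UT UT1): Cts' => <-.
  have [v2 [vz2 vy2]] := conj_wc0 b' Uw vz'; rewrite -Es => ->.
  by rewrite Et Es !comm_wc // vy2.
have lt : (i1 < iy)%N by [].
have Uz := UT_delta (1 : F) lt; rewrite scale1r -ec_er in Uz.
have Ez : comm (lr (er i1)) (1%:M + ec i1 *m er iy) = lr (er iy).
  apply: comm_nil => //.
  - by rewrite mulmxA -(mulmxA _ (er iy)) er_col ec_entry raddf0 ?mulmx0 mul0mx.
  - by rewrite mulmxA -(mulmxA _ (er iy)) er_col ec_entry -val_eqE /= raddf0 ?mulmx0 mul0mx.
  rewrite !mulmxA -!(mulmxA _ (er _) (ec _)) !er_col !ec_entry eqxx mulmx1.
  by rewrite raddf0 ?mulmx0 mul0mx addr0.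
have := Call _ (PC_UT PC Uz); rewrite -PC_comm // Ez.
have Uy : is_UT (lr (er iy)) by apply: UT_lr; rewrite er_entry.
move/(PC_commute PC Ut Uy); case/lr_tc_noncommute => //.
by rewrite ec_entry eqxx.
Qed.

Lemma qf_central_of_super : phi (tc (ec iy)) iy iz != 0 -> exists al be : F,
  qf_central (fun a => std_subcentral al be (phi a)).
Proof.
move=> tyz; have s01 := super_t1 tyz.
have UT := PC_UT PC Ut; have UT1 := PC_UT PC Ut1.
have [b [v [vz vy Et]]] := shape_last_column hchar UT Ht tyz.
have [c [r [r0 r1 Es]]] := shape_first_row hchar UT1 Ht1 s01.
(* These cancel the [(2, z)] entry [c] of the image of [lr (er i1)] and the [(1, y)] entry [b] of
   the image of [tc (ec iy)]. Neither correction disturbs the other image, where the controlling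
   entry is zero. *)
exists (- (c / r 0 i1)), (- (b / v iy 0)).
apply: (@qf_central_of_tc F m _ v r) => //; last 2 first.
- by rewrite vy.
- rewrite subcentralE //.
  have -> : phi (lr (er i1)) iy iz = 0.
    by rewrite Es wr_entry -!val_eqE /= ltn_eqF // !mul0r !addr0.
  rewrite -r1 mulNr divfK ?r1 // mulr0 scale0r addr0 Es /wr /lr scaleNr -scalemxAr.
  by rewrite addrA addrK.
- exact: PC_comp PC (PC_subcentral _ _ _).
rewrite subcentralE //.
have -> : phi (tc (ec iy)) i0 i1 = 0.
  rewrite Et /wc mxE [X in X + _]mxE [X in _ + X]mxE !mul_er_entry -!val_eqE /=.
  by rewrite !mulr0 !addr0.
rewrite mulr0 scale0r add0r -vy mulNr divfK ?vy // Et /wc scaleNr -scalemxAl.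
by rewrite [_ *: _ + _]addrC addrA addrK.
Qed.

End Generators.

End SecondCenter.

(** * The graph automorphism and the decomposition *)

Section Graph.
Variables (F : fieldType) (n : nat).
Implicit Types A B a x y : 'M[F]_n.

(** Reflection in the antidiagonal, an anti-automorphism; composed with inversion it is the graph
    automorphism on invertible matrices. *)
Definition flip A : 'M[F]_n := \matrix_(i, j) A (rev_ord j) (rev_ord i).

Lemma flipK A : flip (flip A) = A.
Proof. by apply/matrixP=> i j; rewrite !mxE !rev_ordK. Qed.

Lemma flip_mul A B : flip (A *m B) = flip B *m flip A.
Proof.
apply/matrixP=> i j; rewrite !mxE (reindex_inj rev_ord_inj) /=.
by apply: eq_bigr => k _; rewrite !mxE mulrC.
Qed.

Lemma flip1 : flip 1%:M = 1%:M.
Proof. by apply/matrixP=> i j; rewrite !mxE (inj_eq rev_ord_inj) eq_sym. Qed.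

Lemma flip_unit A : A \in unitmx -> flip A \in unitmx.
Proof.
move=> uA; have E : flip A *m flip (invmx A) = 1%:M by rewrite -flip_mul mulVmx ?flip1.
by case: (mulmx1_unit E).
Qed.

Lemma flip_inv A : A \in unitmx -> flip (invmx A) = invmx (flip A).
Proof.
move=> uA; have uf := flip_unit uA.
by apply: (can_inj (mulKmx uf)); rewrite mulmxV // -flip_mul mulVmx // flip1.
Qed.

Lemma wmx_mul A i j : (wmx F n *m A) i j = A (rev_ord i) j.
Proof.
rewrite mxE (bigD1 (rev_ord i)) //= big1 ?addr0 => [|k nk]; rewrite mxE /=.
  by have := ltn_ord i; case: eqP => [_|]; rewrite ?mul1r //; lia.
case: eqP => [E|]; last by rewrite mul0r.
case/eqP: nk; apply: ord_inj => /=; have := ltn_ord i; lia.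
Qed.

Lemma mul_wmx A i j : (A *m wmx F n) i j = A i (rev_ord j).
Proof.
rewrite mxE (bigD1 (rev_ord j)) //= big1 ?addr0 => [|k nk]; rewrite mxE /=.
  by have := ltn_ord j; case: eqP => [_|]; rewrite ?mulr1 //; lia.
case: eqP => [E|]; last by rewrite mulr0.
case/eqP: nk; apply: ord_inj => /=; have := ltn_ord j; lia.
Qed.

Lemma invmx_wmx : invmx (wmx F n) = wmx F n.
Proof.
have ww : wmx F n *m wmx F n = 1%:M.
  apply/matrixP=> i j; rewrite wmx_mul !mxE /= -val_eqE /=.
  have := ltn_ord i; have := ltn_ord j.
  by case: eqP; case: eqP => //=; lia.
have [uw _] := mulmx1_unit ww.
by apply: (can_inj (mulKmx uw)); rewrite mulmxV.
Qed.

Lemma graphE x : x \in unitmx -> graph_nontriv x = flip (invmx x).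
Proof.
move=> ux; rewrite /graph_nontriv invmx_wmx -trmx_inv.
by apply/matrixP=> i j; rewrite mul_wmx wmx_mul !mxE.
Qed.

Lemma UT_flip x : is_UT x -> is_UT (flip x).
Proof.
move=> Ux; apply/is_UTP=> i j le; rewrite mxE (is_UTP _ Ux) /=; last lia.
by rewrite (inj_eq rev_ord_inj) eq_sym.
Qed.

Lemma UT_graph x : is_UT x -> is_UT (graph_nontriv x).
Proof. by move=> Ux; rewrite graphE ?UT_unit // UT_flip // UT_inv. Qed.

Lemma graphK x : is_UT x -> graph_nontriv (graph_nontriv x) = x.
Proof.
move=> Ux; rewrite graphE ?UT_unit ?UT_graph // graphE ?UT_unit //.
by rewrite -flip_inv ?unitmx_inv ?UT_unit // invmxK flipK.
Qed.

Lemma PC_graph : PC_map (@graph_nontriv F n).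
Proof.
apply: (PC_morph UT_graph UT_graph graphK graphK) => x y Ux Uy.
by rewrite !graphE ?UT_unit ?UT_mul // invmx_mul ?UT_unit // flip_mul.
Qed.

End Graph.

Lemma PC_map_decomposition (F : fieldType) (m : nat) (hchar : (2%:R : F) != 0)
    (phi : 'M[F]_m.+4 -> 'M[F]_m.+4) :
  PC_map phi ->
  exists (b : bool) (alpha beta : F) (P : 'M[F]_m.+4)
         (theta : {rmorphism F -> F}) (c : 'M[F]_m.+4 -> 'M[F]_m.+4),
    [/\ is_T P, bijective theta, central_PC c &
      {in @is_UT F m.+4, forall a,
         phi a = graph_aut b (std_subcentral alpha beta
                   (quasi_inner P (field_aut theta (c a))))}].
Proof.
move=> PC.
have [tyz|t01] := eqVneq (phi (tc (ec F (ixy m))) (ixy m) (ixz m)) 0; last first.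
  have [al [be [P [theta [c [TP bt Cc E]]]]]] := qf_central_of_super hchar PC t01.
  (* Negating both parameters inverts the subcentral map. *)
  exists false, (- al), (- be), P, theta, c; split=> // a Ua.
  by rewrite /= -E // subcentralK // PC_UT.
have [t01|] := super_t PC; last by rewrite tyz eqxx.
have Ut : is_UT (tc (ec F (ixy m))).
  by apply: UT_tc; rewrite ec_entry -val_eqE /= gtn_eqF.
have Up := PC_UT PC Ut.
(* The graph automorphism moves entry [(1, 2)] to [(y, z)] with a change of sign, which reduces this
   case to the previous one. *)
have tyz' : graph_nontriv (phi (tc (ec F (ixy m)))) (ixy m) (ixz m) != 0.
  rewrite graphE ?UT_unit // mxE.
  have -> : rev_ord (ixz m) = ix0 m by apply: ord_inj => /=; lia.
  have -> : rev_ord (ixy m) = ix1 m by apply: ord_inj => /=; lia.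
  have [+ _] := UT_super Up (UT_inv Up); rewrite mulmxV ?UT_unit // mxE /= => E.
  by apply: contraNneq t01 => E'; rewrite E' addr0 in E; rewrite -E.
have [al [be [P [theta [c [TP bt Cc E]]]]]] :=
  qf_central_of_super hchar (PC_comp PC (@PC_graph F _)) tyz'.
exists true, (- al), (- be), P, theta, c; split=> // a Ua.
by rewrite /= -E // subcentralK ?UT_graph ?graphK // PC_UT.
Qed.

Theorem mainTheorem13 (F : fieldType) (n : nat) (hn : (4 <= n)%N)
    (hchar : (2%:R : F) != 0) (phi : 'M[F]_n -> 'M[F]_n) :
  PC_map phi ->
  exists (b : bool) (alpha beta : F) (P : 'M[F]_n)
         (theta : {rmorphism F -> F}) (c : 'M[F]_n -> 'M[F]_n),
    [/\ is_T P, bijective theta, central_PC c &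
      {in @is_UT F n, forall a,
         phi a = graph_aut b (std_subcentral alpha beta
                   (quasi_inner P (field_aut theta (c a))))}].
Proof.
case: n hn phi => [|[|[|[|m]]]] // _ phi; exact: PC_map_decomposition.
Qed.
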